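(* Let $p\in(0,\infty)$, and let $\{p,\kappa_{d,p}\}$ and $\{\infty,\kappa_{d,\infty}\}$ have asymptotic sizes in $(0,1)$. Then $$\mathscr{C}(\{p,\kappa_{d,p}\})\not\subseteq\mathscr{C}(\{\infty,\kappa_{d,\infty}\})\quad\text{and}\quad\mathscr{C}(\{\infty,\kappa_{d,\infty}\})\not\subseteq\mathscr{C}(\{p,\kappa_{d,p}\}).$$
   Context: Let $\varepsilon_1,\varepsilon_2,\dots$ be i.i.d. standard normal random variables and $\boldsymbol{\varepsilon}_d = (\varepsilon_1,\dots,\varepsilon_d)$. A (sequence of) test(s) is a sequence $\varphi_d$, $d\in\mathbb{N}$, of Borel measurable functions $\varphi_d:\mathbb{R}^d \to [0,1]$; it has asymptotic size $\alpha\in[0,1]$ if $\lim_{d\to\infty}\mathbb{E}(\varphi_d(\boldsymbol{\varepsilon}_d)) = \alpha$. Let $\boldsymbol{\Theta} := \prod_{d=1}^\infty \mathbb{R}^d$ be the set of all triangular arrays $\boldsymbol{\vartheta} = \{\boldsymbol{\theta}_d: d\in\mathbb{N}\}$, $\boldsymbol{\theta}_d\in\mathbb{R}^d$. The consistency set $\mathscr{C}(\varphi_d)\subseteq\boldsymbol{\Theta}$ of a sequence of tests $\varphi_d$ is the set of all $\boldsymbol{\vartheta}\in\boldsymbol{\Theta}$ with $\lim_{d\to\infty}\mathbb{E}(\varphi_d(\boldsymbol{\theta}_d+\boldsymbol{\varepsilon}_d)) = 1$. For $\boldsymbol{x}\in\mathbb{R}^d$, $\|\boldsymbol{x}\|_p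 := (\sum_{i=1}^d |x_i|^p)^{1/p}$ if $p\in(0,\infty)$ (also for $p<1$) and $\|\boldsymbol{x}\|_\infty := \max_{i}|x_i|$. For $p\in(0,\infty]$ and a sequence of real critical values $\kappa_d$, $\{p,\kappa_d\}$ denotes the sequence of tests $\mathbf{1}\{\|\cdot\|_p \ge \kappa_d\}$. *)

(* Defs.v *)
From HB Require Import structures.
From mathcomp Require Import all_boot all_order all_algebra.
From mathcomp Require Import finmap.
From mathcomp Require Import all_classical all_reals all_analysis.
From mathcomp Require Import measurable_realfun.
Set Implicit Arguments.
Unset Strict Implicit.
Unset Printing Implicit Defensive.
Import Order.TTheory GRing.Theory Num.Theory.
Import numFieldNormedType.Exports.
Local Open Scope classical_set_scope.
Local Open Scope ring_scope.

Notation borel_rV R d := (g_sigma_algebraType (@open 'rV[R]_d)).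

Record test (R : realType) (d : nat) := Test {
  test_fun :> 'rV[R]_d -> R;
  test_measurable :
    measurable_fun [set: borel_rV R d] (test_fun : borel_rV R d -> R);
  test_itv : forall x, 0 <= test_fun x <= 1 }.

(* Sequences are indexed by all d : nat. The extra entry d = 0 lives on the
   one-point space 'rV_0 and does not affect any limit; since 'rV_0 has a single
   element, [triangular_array R] is in bijection with the product of the R^d
   over d >= 1. *)
Definition triangular_array (R : realType) : Type := forall d : nat, 'rV[R]_d.

Definition mutually_independent (R : realType) (disp : measure_display)
    (T : measurableType disp) (P : probability T R)
    (X : nat -> {RV P >-> R}) : Prop :=
  forall (J : {fset nat}) (A : nat -> set R),
    (forall j, j \in J -> measurable (A j)) ->
    (P (\bigcap_(j in [set` J]) X j @^-1` A j) =
     \prod_(j <- J) P (X j @^-1` A j))%E.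

(* [normal_prob m s] takes the standard deviation s. The two set functions are
   compared on Borel sets only: their values elsewhere are meaningless. *)
Definition iid_standard_normal (R : realType) (disp : measure_display)
    (T : measurableType disp) (P : probability T R)
    (eps : nat -> {RV P >-> R}) : Prop :=
  (forall (i : nat) (A : set R), measurable A ->
     distribution P (eps i) A = normal_prob 0 1 A) /\
  mutually_independent eps.

(* The sequence eps starts at index 0. *)
Definition noise (R : realType) (disp : measure_display)
    (T : measurableType disp) (P : probability T R)
    (eps : nat -> {RV P >-> R}) (d : nat) (w : T) : 'rV[R]_d :=
  \row_(i < d) eps i w.

Definition asymptotic_size (R : realType) (disp : measure_display)
    (T : measurableType disp) (P : probability T R)
    (eps : nat -> {RV P >-> R}) (phi : forall d, test R d) (alpha : R) : Prop :=
  ('E_P[fun w => phi d (noise eps d w)] @[d --> \oo] --> alpha%:E)%E.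

Definition consistency_set (R : realType) (disp : measure_display)
    (T : measurableType disp) (P : probability T R)
    (eps : nat -> {RV P >-> R}) (phi : forall d, test R d) :
    set (triangular_array R) :=
  [set theta : triangular_array R |
    ('E_P[fun w => phi d (theta d + noise eps d w)%R] @[d --> \oo] --> 1)%E].

(* Only 0 < p <= +oo is meaningful; the value at -oo is a placeholder. *)
Definition pnorm (R : realType) (p : \bar R) (d : nat) (x : 'rV[R]_d) : R :=
  match p with
  | r%:E => (\sum_(i < d) `|x ord0 i| `^ r) `^ r^-1
  | +oo%E => \big[Num.max/0]_(i < d) `|x ord0 i|
  | -oo%E => 0
  end.

Section norm_test.
Variables (R : realType) (p : \bar R).

Lemma measurable_coord (d : nat) (i : 'I_d) :
  measurable_fun [set: borel_rV R d] (fun x : borel_rV R d => (x : 'rV[R]_d) ord0 i).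
Proof.
apply: (measurability _ (RGenOInfty.measurableE R)).
move=> _ [_ [a ->] <-].
rewrite setTI; apply: sub_sigma_algebra.
have /continuousP := @coord_continuous R 1 d ord0 i.
by apply; exact: interval_open.
Qed.

Lemma measurable_pnorm (d : nat) :
  measurable_fun [set: borel_rV R d] (@pnorm R p d : borel_rV R d -> R).
Proof.
have mn (i : 'I_d) : measurable_fun [set: borel_rV R d]
    (fun x : borel_rV R d => `|(x : 'rV[R]_d) ord0 i|).
  exact: measurableT_comp (measurable_coord i).
case: p => [r| |] /=.
- apply: (measurableT_comp (measurable_powR _)).
  apply: measurable_sum => i.
  exact: (measurableT_comp (measurable_powR _)).
- rewrite /pnorm; elim: (index_enum 'I_d) => [|i s ih].
    rewrite [X in measurable_fun _ X](_ : _ = fun=> 0).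
      exact: measurable_cst.
    by apply/funext => x; rewrite big_nil.
  rewrite [X in measurable_fun _ X](_ : _ = fun x : borel_rV R d =>
      Num.max `|(x : 'rV[R]_d) ord0 i|
              (\big[Num.max/0]_(j <- s) `|(x : 'rV[R]_d) ord0 j|)).
    exact: measurable_maxr.
  by apply/funext => x; rewrite big_cons.
- exact: measurable_cst.
Qed.

Definition norm_test_fun (kappa : R) (d : nat) : 'rV[R]_d -> R :=
  \1_[set x : 'rV[R]_d | kappa <= pnorm p x].

Lemma norm_test_measurable (kappa : R) (d : nat) :
  measurable_fun [set: borel_rV R d] (norm_test_fun kappa (d := d) : borel_rV R d -> R).
Proof.
apply/(measurable_indicP R).
rewrite [X in measurable X](_ : _ = @pnorm R p d @^-1` `[kappa, +oo[).
  rewrite -[X in measurable X]setTI.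
  by apply: (measurable_pnorm (d := d)).
by apply/seteqP; split=> x /=; rewrite in_itv/= andbT.
Qed.

Lemma norm_test_itv (kappa : R) (d : nat) (x : 'rV[R]_d) :
  0 <= norm_test_fun kappa x <= 1.
Proof. by rewrite /norm_test_fun indicE; case: (_ \in _); rewrite ?lexx ler01. Qed.

Definition norm_test (kappa : nat -> R) (d : nat) : test R d :=
  Test (norm_test_measurable (kappa d) (d := d)) (norm_test_itv (kappa d) (d := d)).

End norm_test.

(* Main.v *)
Require Import Defs.
From HB Require Import structures.
From mathcomp Require Import all_boot all_order all_algebra.
From mathcomp Require Import finmap.
From mathcomp Require Import all_classical all_reals all_analysis.
From mathcomp Require Import measurable_realfun.
From mathcomp Require Import ring lra.
Import Order.TTheory GRing.Theory Num.Theory.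
Import numFieldNormedType.Exports.
Set Implicit Arguments.
Unset Strict Implicit.
Unset Printing Implicit Defensive.
Local Open Scope classical_set_scope.
Local Open Scope ring_scope.

(** Write [S] for the sum of the [`|eps_i|^p], [i < d], and [s = d^(1/8)].

    A spike: [theta] has one nonzero coordinate [c], at position [j], with
    [(2 c)^p = s]. As [d P(|eps_0| >= c / 2)] tends to 0, the critical value of the
    supremum test is eventually below [c / 2], so that this test is consistent. For
    the [p]-norm test the spike adds at most [s] to the sum of the other terms; that
    sum falls into a given interval of length [s] with probability [O(s / sqrt d)]
    for some [j], so the rejection probability does not increase in the limit.

    A block: [theta] equals a constant [b + 1] on about [s^5] coordinates. This
    raises the mean of [S] by at least a multiple of [s^5], which exceeds the
    standard deviation, of order [s^4]: the [p]-norm test is consistent. The size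
    of the supremum test forces [P(|eps_0| >= kappa) = O(1 / d)], whence
    [P(|eps_0| >= kappa - (b + 1)) = O(s^-6)] by comparing Gaussian tails, and a
    union bound over the block shows that the supremum test gains no power. *)

(** * Independence of two random variables *)

Section independence.
Context (R : realType) (disp : measure_display) (T : measurableType disp)
  (P : probability T R).

Lemma measurable_preimageT d' (T' : measurableType d') (X : T -> T') (A : set T') :
  measurable_fun setT X -> measurable A -> measurable (X @^-1` A).
Proof. by move=> mX mA; rewrite -[X in measurable X]setTI; exact: mX. Qed.

(** Measurable rectangles form a pi-system generating the product sigma-algebra; finiteness of [m1]
    lets the constant sequence [setT] serve as the exhausting one. *)
Lemma measure_unique_rectangles (m1 m2 : {measure set (R * R)%type -> \bar R}) :
    (m1 setT < +oo)%E -> (forall A B : set R, measurable A -> measurable B ->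
      m1 (A `*` B) = m2 (A `*` B)) ->
  forall C, measurable C -> m1 C = m2 C.
Proof.
move=> m1T H C mC.
pose G : set (set (R * R)%type) := 
  [set C | exists A, measurable A /\ exists B, measurable B /\ C = A `*` B].
apply: (measure_unique G (fun=> setT)) => //.
- rewrite measurable_prod_measurableType //; congr (<<s _ >>).
  rewrite predeqE; split => [[A mA [B mB <-]]|[A [mA [B [mB ->]]]]].
    by exists A; split => //; exists B.
  by exists A => //; exists B.
- move=> _ _ [A1 [mA1 [A2 [mA2 ->]]]] [B1 [mB1 [B2 [mB2 ->]]]].
  rewrite -setXI; exists (A1 `&` B1); split; first exact: measurableI.
  by exists (A2 `&` B2); split => //; exact: measurableI.
- by move=> n; exists setT; split => //; exists setT; rewrite setXTT.
- by apply/seteqP; split => // x _; exists 0%N.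
- by move=> _ [A [mA [B [mB ->]]]]; exact: H.
Qed.

(** As functions of [C], both sides are finite measures on the plane: the image under [(X, Y)] of
    [P] restricted to [E], and the image of [P] scaled by [P E]. The hypothesis is their agreement
    on rectangles. *)
Lemma indep_event_pair (X Y : T -> R) (E : set T) :
    measurable_fun setT X -> measurable_fun setT Y -> measurable E ->
    (forall A B : set R, measurable A -> measurable B ->
      (P (E `&` (X @^-1` A `&` Y @^-1` B)) = P E * P (X @^-1` A `&` Y @^-1` B))%E) ->
  forall C : set (R * R)%type, measurable C ->
    (P (E `&` [set w | C (X w, Y w)]) = P E * P [set w | C (X w, Y w)])%E.
Proof.
move=> mX mY mE H C mC.
pose XY w := (X w, Y w).
have mXY : measurable_fun setT XY by exact: measurable_fun_pair.
have PEfin : P E \is a fin_num by exact: fin_num_measure.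
have PE0 : 0 <= fine (P E) by exact: fine_ge0.
pose m1' : {measure set (R * R)%type -> \bar R} := pushforward (mrestr P mE) XY.
pose m2' : {measure set (R * R)%type -> \bar R} :=
  mscale (NngNum PE0) (pushforward P XY).
pose m1 := m1' mXY; pose m2 := m2' mXY.
have m1E A : m1 A = P (E `&` [set w | A (X w, Y w)]).
  by rewrite /m1 /= /pushforward /mrestr setIC.
have m2E A : (m2 A = P E * P [set w | A (X w, Y w)])%E.
  by rewrite /m2 /= /mscale /= fineK.
rewrite -m1E -m2E; apply: measure_unique_rectangles => // [|A B mA mB].
  by rewrite m1E setIT -ge0_fin_numE//; exact: fin_num_measure.
by rewrite m1E m2E; exact: H.
Qed.

(** Independence identifies the joint law with the product of the marginal laws, and Fubini's
    theorem then separates the two factors. *)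
Lemma indep_integralM (X Y : T -> R) (f g : R -> R) :
    measurable_fun setT X -> measurable_fun setT Y ->
    (forall A B : set R, measurable A -> measurable B ->
      (P (X @^-1` A `&` Y @^-1` B) = P (X @^-1` A) * P (Y @^-1` B))%E) ->
    measurable_fun setT f -> measurable_fun setT g ->
    P.-integrable setT (fun w => (f (X w))%:E) ->
    P.-integrable setT (fun w => (g (Y w))%:E) ->
    P.-integrable setT (fun w => (f (X w) * g (Y w))%:E) ->
  (\int[P]_w (f (X w) * g (Y w))%:E =
   \int[P]_w (f (X w))%:E * \int[P]_w (g (Y w))%:E)%E.
Proof.
move=> mX mY H mf mg fX gY fgXY.
pose XY w := (X w, Y w).
have mXY : measurable_fun setT XY by exact: measurable_fun_pair.
pose Xf : {mfun T >-> R} := HB.pack_for {mfun T >-> R} X (isMeasurableFun.Build _ _ _ _ X mX).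
pose Yf : {mfun T >-> R} := HB.pack_for {mfun T >-> R} Y (isMeasurableFun.Build _ _ _ _ Y mY).
pose XYf : {mfun T >-> (R * R)%type} :=
  HB.pack_for {mfun T >-> (R * R)%type} XY (isMeasurableFun.Build _ _ _ _ XY mXY).
pose PX := distribution P Xf.
pose PY := distribution P Yf.
pose PXY := distribution P XYf.
have mfg : measurable_fun setT (fun z : R * R => (f z.1 * g z.2)%:E).
  apply/measurable_EFinP; apply: measurable_funM.
    exact: measurableT_comp.
  exact: measurableT_comp.
have PE : forall C, measurable C -> PXY C = (PX \x PY)%E C.
  move=> C mC; apply/esym.
  by apply: product_measure_unique => // A B mA mB; exact: H.
have -> : (\int[P]_w (f (X w) * g (Y w))%:E =
           \int[PXY]_z (f z.1 * g z.2)%:E)%E.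
  by rewrite integral_distribution.
have ifg : PXY.-integrable setT (fun z : R * R => (f z.1 * g z.2)%:E).
  exact: integrable_pushforward.
have -> : (\int[PXY]_z (f z.1 * g z.2)%:E =
           \int[(PX \x PY)%E]_z (f z.1 * g z.2)%:E)%E.
  by apply: eq_measure_integral => A mA _; exact: PE.
have ifX : PX.-integrable setT (fun x => (f x)%:E).
  by apply: integrable_pushforward => //; exact/measurable_EFinP.
have igY : PY.-integrable setT (fun x => (g x)%:E).
  by apply: integrable_pushforward => //; exact/measurable_EFinP.
rewrite -integral12_prod_meas1 /=; last first.
  apply/integrableP; split => //.
  rewrite (_ : integral _ _ _ = (\int[PXY]_z `|(f z.1 * g z.2)%:E|)%E).
    by move/integrableP: ifg => [].
  by apply: eq_measure_integral => A mA _; exact/esym/PE.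
rewrite /fubini_F /=.
under eq_integral => x _.
  under eq_integral do rewrite EFinM.
  rewrite integralZl//.
  over.
rewrite /=.
have gfin : (\int[PY]_y (g y)%:E)%E \is a fin_num by exact: integrable_fin_num.
rewrite -(fineK gfin) integralZr//.
by rewrite fineK// !integral_distribution//; exact/measurable_EFinP.
Qed.
End independence.

(** * Real-valued probabilities and integrals, so that estimates take place in [R] rather than
    [\bar R] *)

Definition prob (R : realType) (disp : measure_display) (T : measurableType disp)
  (P : probability T R) (A : set T) : R := fine (P A).

Section prob_theory.
Context (R : realType) (disp : measure_display) (T : measurableType disp)
  (P : probability T R).
Implicit Types (A B : set T) (f g : T -> R).

Local Notation integ f := (P.-integrable [set: T] (EFin \o f)).

Lemma probE A : measurable A -> (prob P A)%:E = P A.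
Proof. by move=> mA; rewrite fineK//; exact: fin_num_measure. Qed.

Lemma prob_ge0 A : 0 <= prob P A.
Proof. exact: fine_ge0. Qed.

Lemma le_prob A B : measurable A -> measurable B -> A `<=` B ->
  prob P A <= prob P B.
Proof.
move=> mA mB AB; rewrite -lee_fin !probE//.
by apply: le_measure => //; rewrite inE.
Qed.

Lemma prob_le1 A : measurable A -> prob P A <= 1.
Proof. by move=> mA; rewrite -lee_fin probE//; exact: probability_le1. Qed.

Lemma prob_setC A : measurable A -> prob P (~` A) = 1 - prob P A.
Proof.
move=> mA; apply: EFin_inj; rewrite EFinB !probE//; last exact: measurableC.
exact: probability_setC.
Qed.

Lemma prob_le_setU A B C : measurable A -> measurable B -> measurable C ->
  A `<=` B `|` C -> prob P A <= prob P B + prob P C.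
Proof.
move=> mA mB mC AB; apply: le_trans (le_prob mA (measurableU _ _ mB mC) AB) _.
rewrite -lee_fin EFinD !probE//; last exact: measurableU.
exact: measureU2.
Qed.

Lemma prob_le_bigU A n (B : nat -> set T) : measurable A ->
  (forall i, measurable (B i)) ->
  A `<=` \big[setU/set0]_(i < n) B i -> prob P A <= \sum_(i < n) prob P (B i).
Proof.
elim: n A => [A mA mB|n IH A mA mB].
  rewrite !big_ord0 => /(le_prob mA measurable0)/le_trans; apply.
  by rewrite /prob measure0.
rewrite !big_ord_recr /= => h.
have mU : measurable (\big[setU/set0]_(i < n) B i) by exact: bigsetU_measurable.
apply: le_trans (prob_le_setU mA mU (mB n) h) _.
by rewrite lerD2r; exact: IH.
Qed.

Lemma integrable_indicR A : measurable A -> integ (\1_A : T -> R).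
Proof. exact: integrable_indic. Qed.

Lemma Rintegral_indic A : measurable A -> \int[P]_w \1_A w = prob P A.
Proof. by move=> mA; rewrite /Rintegral integral_indic// setIT. Qed.

Lemma integrable_addR f g : integ f -> integ g -> integ (fun w => f w + g w).
Proof. exact: integrableD. Qed.

Lemma integrable_subR f g : integ f -> integ g -> integ (fun w => f w - g w).
Proof. exact: integrableB. Qed.

Lemma integrable_mulRl (k : R) f : integ f -> integ (fun w => k * f w).
Proof. exact: integrableZl. Qed.

Lemma integrable_sumR (I : Type) (s : seq I) (h : I -> T -> R) :
  (forall i, integ (h i)) -> integ (fun w => \sum_(i <- s) h i w).
Proof.
move=> ih; elim: s => [|i s IH].
  rewrite (_ : EFin \o _ = cst 0%E); first exact: integrable0.
  by apply/funext => w; rewrite /= big_nil.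
rewrite (_ : EFin \o _ = EFin \o (fun w => h i w + \sum_(j <- s) h j w)).
  exact: integrable_addR.
by apply/funext => w; rewrite /= big_cons.
Qed.

Lemma Rintegral_sum (I : Type) (s : seq I) (h : I -> T -> R) :
  (forall i, integ (h i)) ->
  \int[P]_w (\sum_(i <- s) h i w) = \sum_(i <- s) \int[P]_w h i w.
Proof.
move=> ih; elim: s => [|i s IH].
  rewrite big_nil (_ : (fun w => _) = cst 0) ?Rintegral_cst ?mul0r//.
  by apply/funext => w; rewrite /= big_nil.
rewrite big_cons -IH -RintegralD//; last exact: integrable_sumR.
by congr Rintegral; apply/funext => w; rewrite big_cons.
Qed.

Lemma le_integrableR f g : measurable_fun setT f ->
  (forall w, `|f w| <= g w) -> integ g -> integ f.
Proof.
move=> mf fg; apply: le_integrable => //; first exact/measurable_EFinP.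
by move=> w _; rewrite /= lee_fin (le_trans (fg w))// ler_norm.
Qed.

Lemma integrable_cstR (k : R) : integ (fun=> k).
Proof. exact: finite_measure_integrable_cst. Qed.

Lemma Rintegral_cstR (k : R) : \int[P]_w k = k.
Proof.
have P1 : fine (P setT) = 1 by rewrite probability_setT.
by rewrite Rintegral_cst// -[RHS]mulr1 -[in RHS]P1.
Qed.

(** Domination by [f^2 + g^2]. *)
Lemma integrable_mulR f g : measurable_fun setT f -> measurable_fun setT g ->
  integ (fun w => f w ^+ 2) -> integ (fun w => g w ^+ 2) ->
  integ (fun w => f w * g w).
Proof.
move=> mf mg if2 ig2; apply: (@le_integrableR _ (fun w => f w ^+ 2 + g w ^+ 2)).
- exact: measurable_funM.
- move=> w; rewrite normrM -(real_normK (num_real (f w))) -(real_normK (num_real (g w))).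
  by have := sqr_ge0 (`|f w| - `|g w|); have := normr_ge0 (f w);
     have := normr_ge0 (g w); nra.
- exact: integrable_addR.
Qed.

Lemma integrable_sqrW f : measurable_fun setT f ->
  integ (fun w => f w ^+ 2) -> integ f.
Proof.
move=> mf if2; rewrite (_ : EFin \o f = EFin \o (fun w => f w * 1)).
  apply: integrable_mulR => //.
  by under eq_fun do rewrite expr1n; exact: integrable_cstR.
by apply/funext => w /=; rewrite mulr1.
Qed.

(** Markov's inequality in the form [1_A <= f]; it is applied below to rescaled squares, powers and
    exponentials. *)
Lemma prob_le_Rintegral A f : measurable A -> integ f ->
  (forall w, 0 <= f w) -> (forall w, A w -> 1 <= f w) ->
  prob P A <= \int[P]_w f w.
Proof.
move=> mA intf f0 Af; rewrite -Rintegral_indic//; apply: le_Rintegral => //.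
  exact: integrable_indicR.
move=> w _; rewrite indicE; case: (boolP (w \in A)) => [|_]; last exact: f0.
by rewrite inE; exact: Af.
Qed.

Lemma measurable_geR f (a : R) : measurable_fun setT f ->
  measurable [set w | a <= f w].
Proof.
move=> mf; rewrite (_ : [set w | _] = f @^-1` `[a, +oo[).
  exact: measurable_preimageT.
by apply/seteqP; split => w /=; rewrite in_itv/= andbT.
Qed.

Lemma measurable_leR f (a : R) : measurable_fun setT f ->
  measurable [set w | f w <= a].
Proof.
move=> mf; rewrite (_ : [set w | _] = f @^-1` `]-oo, a]).
  exact: measurable_preimageT.
by apply/seteqP; split => w /=; rewrite in_itv.
Qed.

Lemma measurable_ltR f (a : R) : measurable_fun setT f ->
  measurable [set w | f w < a].
Proof.
move=> mf; rewrite (_ : [set w | _] = f @^-1` `]-oo, a[).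
  exact: measurable_preimageT.
by apply/seteqP; split => w /=; rewrite in_itv.
Qed.

(** Pythagoras in L2: by induction on [n], every cross term has zero integral. *)
Lemma Rintegral_sum_sqr n (h : nat -> T -> R) :
    (forall i, measurable_fun setT (h i)) ->
    (forall i, integ (fun w => h i w ^+ 2)) ->
    (forall i j, i != j -> \int[P]_w (h i w * h j w) = 0) ->
  integ (fun w => (\sum_(i < n) h i w) ^+ 2) /\
  \int[P]_w (\sum_(i < n) h i w) ^+ 2 = \sum_(i < n) \int[P]_w h i w ^+ 2.
Proof.
move=> mh ih2 hh.
have ihh i j : integ (fun w => h i w * h j w) by exact: integrable_mulR.
elim: n => [|n [IHi IHe]].
  rewrite big_ord0 (_ : (fun w => _) = cst 0).
    by split; [exact: integrable0|rewrite Rintegral_cst ?mul0r].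
  by apply/funext => w; rewrite big_ord0 expr0n.
have E : (fun w => (\sum_(i < n.+1) h i w) ^+ 2) =
  fun w => ((\sum_(i < n) h i w) ^+ 2 + 2 * (\sum_(i < n) h i w * h n w)) + h n w ^+ 2.
  apply/funext => w; rewrite big_ord_recr /= -mulr_suml.
  by ring.
have i1 : integ (fun w => \sum_(i < n) h i w * h n w).
  exact: (@integrable_sumR _ _ (fun i w => h (nat_of_ord i) w * h n w)).
have i2 := integrable_mulRl 2 i1.
have i3 := integrable_addR IHi i2.
rewrite E; split; first exact: integrable_addR.
rewrite RintegralD// RintegralD// RintegralZl// IHe big_ord_recr /=.
rewrite (@Rintegral_sum _ _ (fun i w => h (nat_of_ord i) w * h n w))//.
rewrite [X in _ + 2 * X]big1 ?mulr0 ?addr0// => i _; apply: hh.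
by rewrite neq_ltn ltn_ord.
Qed.

End prob_theory.

(** * Sums of independent, identically distributed variables *)

Section iid.
Context (R : realType) (disp : measure_display) (T : measurableType disp)
  (P : probability T R) (X : nat -> {RV P >-> R}).
Hypothesis hind : mutually_independent X.

(** Independence for duplicate-free lists instead of finite sets, a form suited to induction on the
    list. *)
Lemma mutually_independent_seq (J : seq nat) (A : nat -> set R) : uniq J ->
  (forall j, measurable (A j)) ->
  (P (\big[setI/setT]_(j <- J) (X j @^-1` A j)) = \prod_(j <- J) P (X j @^-1` A j))%E.
Proof.
move=> uJ mA; have := @hind [fset j in J]%fset A (fun j _ => mA j).
rewrite bigcap_fset !(perm_big _ (uniq_perm (fset_uniq _) uJ _))//.
  by move=> j; rewrite in_fset.
by move=> j; rewrite in_fset.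
Qed.

Lemma measurable_RV (i : nat) (A : set R) : measurable A -> measurable (X i @^-1` A).
Proof. by move=> mA; exact: measurable_preimageT. Qed.

Lemma measurable_comp_RV (g : R -> R) i : measurable_fun setT g ->
  measurable_fun setT (fun w => g (X i w)).
Proof. by move=> mg; exact: measurableT_comp. Qed.

Lemma measurable_sum_RV (g : R -> R) (J : seq nat) : measurable_fun setT g ->
  measurable_fun setT (fun w => \sum_(j <- J) g (X j w)).
Proof.
by move=> mg; apply: measurable_sum => j; exact: measurable_comp_RV.
Qed.

(** Induction on [J] for all [E] at once. With head [i] and tail sum [S], the induction hypothesis
    is used for the event [X i \in C] and for its intersection with [E]. Together they make [E]
    independent of the pair [(X i, S)], hence of [g (X i) + S]. *)
Lemma indep_event_sum (g : R -> R) (J : seq nat) (E : set T) :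
    measurable_fun setT g -> uniq J -> measurable E ->
    (forall A : nat -> set R, (forall j, measurable (A j)) ->
      (P (E `&` \big[setI/setT]_(j <- J) (X j @^-1` A j)) =
       P E * \prod_(j <- J) P (X j @^-1` A j))%E) ->
  forall B : set R, measurable B ->
    (P (E `&` [set w | B (\sum_(j <- J) g (X j w))%R]) =
     P E * P [set w | B (\sum_(j <- J) g (X j w))%R])%E.
Proof.
move=> mg; elim: J E => [|i J IH] E /= + mE hE B mB.
  move=> _.
  rewrite (_ : [set w | _] = [set w | B 0]); last first.
    by apply/funext => w; rewrite /= big_nil.
  have [B0|B0] := pselect (B 0).
    rewrite (_ : [set w | _] = setT); last by apply/seteqP; split.
    by rewrite setIT probability_setT mule1.
  rewrite (_ : [set w | _] = set0); last by apply/seteqP; split.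
  by rewrite setI0 measure0 mule0.
move=> /andP[iJ uJ].
(* As [i] is not in [J], one family of sets can impose [C] on [X i] and [A j] on the other
   variables. *)
have ifE (A : nat -> set R) (C : set R) :
    (\big[setI/setT]_(j <- i :: J) (X j @^-1` (if j == i then C else A j)) =
     X i @^-1` C `&` \big[setI/setT]_(j <- J) (X j @^-1` A j)) /\
    (\prod_(j <- i :: J) P (X j @^-1` (if j == i then C else A j)) =
     P (X i @^-1` C) * \prod_(j <- J) P (X j @^-1` A j))%E.
  rewrite !big_cons eqxx; split.
    congr (_ `&` _); apply: eq_big_seq => j jJ; case: eqP => // ji.
    by move: iJ; rewrite -ji jJ.
  congr (_ * _)%E; apply: eq_big_seq => j jJ; case: eqP => // ji.
  by move: iJ; rewrite -ji jJ.
have mif (A : nat -> set R) (C : set R) : (forall j, measurable (A j)) ->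
    measurable C -> forall j, measurable (if j == i then C else A j).
  by move=> mA mC j; case: ifP.
have prod1 : (\prod_(j <- J) P (X j @^-1` setT) = 1)%E.
  by rewrite big1// => j _; rewrite preimage_setT probability_setT.
have cap1 : \big[setI/setT]_(j <- J) (X j @^-1` setT) = setT.
  by rewrite big1// => j _; rewrite preimage_setT.
have PEi C : measurable C -> (P (E `&` X i @^-1` C) = P E * P (X i @^-1` C))%E.
  move=> mC; have := hE _ (mif (fun=> setT) C (fun=> measurableT) mC).
  have [-> ->] := ifE (fun=> setT) C.
  by rewrite cap1 setIT prod1 mule1.
have IHi C : measurable C -> forall B, measurable B ->
    (P (X i @^-1` C `&` [set w | B (\sum_(j <- J) g (X j w))%R]) =
     P (X i @^-1` C) * P [set w | B (\sum_(j <- J) g (X j w))%R])%E.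
  move=> mC; apply: IH => //; first exact: measurable_RV.
  move=> A mA.
  have := @mutually_independent_seq (i :: J) _ _ (mif A C mA mC).
  have [-> ->] := ifE A C.
  by apply; rewrite /= iJ.
have IHE C : measurable C -> forall B, measurable B ->
    (P (E `&` (X i @^-1` C) `&` [set w | B (\sum_(j <- J) g (X j w))%R]) =
     P (E `&` X i @^-1` C) * P [set w | B (\sum_(j <- J) g (X j w))%R])%E.
  move=> mC; apply: IH => //.
    by apply: measurableI => //; exact: measurable_RV.
  move=> A mA; have := hE _ (mif A C mA mC).
  by have [-> ->] := ifE A C; rewrite PEi// setIA -muleA.
pose S w := \sum_(j <- J) g (X j w).
have mS : measurable_fun setT S by exact: measurable_sum_RV.
have := @indep_event_pair _ _ _ P (X i) S E _ mS mE _
  ((fun z : R * R => g z.1 + z.2) @^-1` B).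
rewrite (_ : [set w | B (\sum_(j <- i :: J) g (X j w))] = [set w |
    ((fun z : R * R => g z.1 + z.2) @^-1` B) (X i w, S w)]); last first.
  by apply/seteqP; split => w; rewrite /= big_cons.
apply=> //.
  move=> A C mA mC; rewrite setIA.
  have := IHE A mA C mC; rewrite -/(S @^-1` C) => ->.
  have := IHi A mA C mC; rewrite -/(S @^-1` C) => ->.
  by rewrite PEi// muleA.
apply: measurable_preimageT => //.
apply: measurable_funD => //.
exact: measurableT_comp.
Qed.

(** An instance of [indep_event_sum], with [E] the event [X j \in A] and the list of all indices
    other than [j]. *)
Lemma indep_sum_others (g : R -> R) (n : nat) (j : 'I_n) (A B : set R) :
    measurable_fun setT g -> measurable A -> measurable B ->
  (P (X j @^-1` A `&` [set w | B (\sum_(i < n | i != j) g (X i w))%R]) =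
   P (X j @^-1` A) * P [set w | B (\sum_(i < n | i != j) g (X i w))%R])%E.
Proof.
move=> mg mA mB.
pose J := [seq i <- index_iota 0 n | i != j :> nat].
have E w : \sum_(i < n | i != j) g (X i w) = \sum_(i <- J) g (X i w).
  by rewrite big_filter big_mkord.
under eq_set do rewrite E.
have uJ : uniq J by rewrite filter_uniq// iota_uniq.
have jJ : nat_of_ord j \notin J by rewrite mem_filter eqxx.
apply: (@indep_event_sum g J (X j @^-1` A)) => //; first exact: measurable_RV.
move=> C mC.
have mjC i : measurable (if i == nat_of_ord j then A else C i) by case: ifP.
have := @mutually_independent_seq (nat_of_ord j :: J) _ _ mjC.
rewrite /= jJ uJ => /(_ isT); rewrite !big_cons eqxx.
have ne i : i \in J -> (i == j :> nat) = false.
  by rewrite mem_filter => /andP[/negbTE].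
rewrite (eq_big_seq (fun i => X i @^-1` C i)); last by move=> i /ne /= ->.
by rewrite [X in (_ * X)%E](eq_big_seq (fun i => P (X i @^-1` C i)))// => i /ne /= ->.
Qed.

Lemma indep_pair (i j : nat) (A B : set R) : i != j -> measurable A -> measurable B ->
  (P (X i @^-1` A `&` X j @^-1` B) = P (X i @^-1` A) * P (X j @^-1` B))%E.
Proof.
move=> ij mA mB.
have ml k : measurable (if k == i then A else B) by case: ifP.
have := @mutually_independent_seq [:: i; j] _ _ ml.
rewrite /= inE ij => /(_ isT); rewrite !big_cons !big_nil eqxx.
by rewrite eq_sym (negbTE ij) setIT mule1.
Qed.

Hypothesis hid : forall i (A : set R), measurable A ->
  P (X i @^-1` A) = P (X 0%N @^-1` A).

Local Notation integ f := (P.-integrable [set: T] (EFin \o f)).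

Lemma iid_integrable (f : R -> R) i : measurable_fun setT f ->
  integ (fun w => f (X 0%N w)) -> integ (fun w => f (X i w)).
Proof.
move=> mf /integrableP[mf0 if0]; apply/integrableP; split.
  exact/measurable_EFinP/measurable_comp_RV.
have mg : measurable_fun setT (fun x : R => `|(f x)%:E|%E).
  by apply: measurableT_comp => //; exact/measurable_EFinP.
move: if0.
rewrite -[X in (X < _)%E](@ge0_integral_distribution _ _ _ _ _ P (X 0%N) _ mg)//.
rewrite -[X in _ -> (X < _)%E](@ge0_integral_distribution _ _ _ _ _ P (X i) _ mg)//.
rewrite (@eq_measure_integral _ _ _ setT (distribution P (X i)) (distribution P (X 0%N)))//.
by move=> A mA _; exact/esym/hid.
Qed.

Lemma iid_Rintegral (f : R -> R) i : measurable_fun setT f ->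
  integ (fun w => f (X 0%N w)) ->
  \int[P]_w f (X i w) = \int[P]_w f (X 0%N w).
Proof.
move=> mf if0; have ifi := iid_integrable i mf if0.
have mg : measurable_fun setT (fun x : R => (f x)%:E) by exact/measurable_EFinP.
rewrite /Rintegral.
rewrite -[X in fine X = _](@integral_distribution _ _ _ _ _ P (X i) _ mg)//.
rewrite -[X in _ = fine X](@integral_distribution _ _ _ _ _ P (X 0%N) _ mg)//.
rewrite (@eq_measure_integral _ _ _ setT (distribution P (X i)) (distribution P (X 0%N)))//.
by move=> A mA _; exact/esym/hid.
Qed.

Lemma iid_prob i (A : set R) : measurable A ->
  prob P (X i @^-1` A) = prob P (X 0%N @^-1` A).
Proof. by move=> mA; rewrite /prob hid. Qed.

(** Independence and centering make the variables [g (X i)] pairwise orthogonal. *)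
Lemma iid_centered_second_moment (g : R -> R) n : measurable_fun setT g ->
    integ (fun w => g (X 0%N w) ^+ 2) -> \int[P]_w g (X 0%N w) = 0 ->
  integ (fun w => (\sum_(i < n) g (X i w)) ^+ 2) /\
  \int[P]_w (\sum_(i < n) g (X i w)) ^+ 2 = n%:R * \int[P]_w g (X 0%N w) ^+ 2.
Proof.
move=> mg ig2 g0.
have mg2 : measurable_fun setT (fun x => g x ^+ 2) by exact: measurable_funX.
have mgX i := measurable_comp_RV i mg.
have ig2i i := iid_integrable i mg2 ig2.
have ig : integ (fun w => g (X 0%N w)) by exact: integrable_sqrW.
have igi i := iid_integrable i mg ig.
have [|-> ->] := @Rintegral_sum_sqr _ _ _ P n (fun i w => g (X i w)) mgX ig2i.
  move=> i j ij; rewrite /Rintegral.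
  rewrite (@indep_integralM _ _ _ P (X i) (X j))//.
  - rewrite fineM; last 2 first.
      by apply: integrable_fin_num => //; exact: igi.
      by apply: integrable_fin_num => //; exact: igi.
    by have := iid_Rintegral i mg ig; rewrite g0 /Rintegral => ->; rewrite mul0r.
  - by move=> A B mA mB; exact: indep_pair.
  - exact: igi.
  - exact: igi.
  - exact: integrable_mulR.
split => //.
under eq_bigr do rewrite (iid_Rintegral _ mg2 ig2).
by rewrite sumr_const card_ord mulr_natl.
Qed.

(** Markov's inequality for the square of the centered sum, whose mean is [n] times the variance of
    one term. *)
Lemma iid_chebyshev (g : R -> R) n (l : R) : measurable_fun setT g -> 0 < l ->
    integ (fun w => g (X 0%N w) ^+ 2) ->
  prob P [set w | l <= `|\sum_(i < n) g (X i w) - n%:R * \int[P]_w g (X 0%N w)|] <=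
  n%:R * \int[P]_w (g (X 0%N w) - \int[P]_w g (X 0%N w)) ^+ 2 / l ^+ 2.
Proof.
move=> mg l0 ig2; set m := \int[P]_w g (X 0%N w).
pose f x := g x - m.
have mf : measurable_fun setT f by exact: measurable_funB.
have ig : integ (fun w => g (X 0%N w)).
  by apply: integrable_sqrW => //; exact: measurable_comp_RV.
have if2 : integ (fun w => f (X 0%N w) ^+ 2).
  rewrite (_ : (fun w => _) = fun w => (g (X 0%N w) ^+ 2 - (2 * m) * g (X 0%N w)) + m ^+ 2).
    apply: integrable_addR; last exact: integrable_cstR.
    by apply: integrable_subR => //; exact: integrable_mulRl.
  by apply/funext => w; rewrite /f; ring.
have f0 : \int[P]_w f (X 0%N w) = 0.
  rewrite RintegralB//; last exact: integrable_cstR.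
  by rewrite Rintegral_cstR subrr.
have [i2 e2] := iid_centered_second_moment n mf if2 f0.
have E w : \sum_(i < n) g (X i w) - n%:R * m = \sum_(i < n) f (X i w).
  by rewrite sumrB sumr_const card_ord mulr_natl.
under eq_set do rewrite E.
have mS : measurable_fun setT (fun w => \sum_(i < n) f (X i w)).
  by apply: measurable_sum => i; exact: measurable_comp_RV.
rewrite -/f -e2 mulrC -RintegralZl//.
apply: prob_le_Rintegral.
- by apply: measurable_geR; exact: measurableT_comp.
- exact: integrable_mulRl.
- by move=> w; rewrite mulr_ge0// ?sqr_ge0// invr_ge0 sqr_ge0.
- move=> w /= lw; rewrite mulrC ler_pdivlMr ?exprn_gt0// mul1r.
  by rewrite -(real_normK (num_real (\sum_(i < n) _))) lerXn2r// nnegrE ltW.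
Qed.

End iid.

(** * Anticoncentration *)

Section anticoncentration.
Context (R : realType) (disp : measure_display) (T : measurableType disp)
  (P : probability T R) (X : nat -> {RV P >-> R}).
Hypothesis hind : mutually_independent X.
Hypothesis hid : forall i (A : set R), measurable A ->
  P (X i @^-1` A) = P (X 0%N @^-1` A).
Variables (g : R -> R) (A B : set R) (a b : R).
Hypotheses (mg : measurable_fun setT g) (mA : measurable A) (mB : measurable B).
Hypotheses (gA : forall x, A x -> g x <= a) (gB : forall x, B x -> b <= g x).
Hypotheses (ab : a < b).
Hypotheses (pA : 0 < prob P (X 0%N @^-1` A)) (pB : 0 < prob P (X 0%N @^-1` B)).

Local Notation integ f := (P.-integrable [set: T] (EFin \o f)).

Let S n (j : 'I_n) w := \sum_(i < n | i != j) g (X i w).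

Let mS n (j : 'I_n) : measurable_fun setT (S j).
Proof.
rewrite /S; under eq_fun do rewrite big_mkcond /=.
by apply: measurable_sum => i; case: (i != j) => //; exact: (measurable_comp_RV X).
Qed.

Let prob_indep n (j : 'I_n) (C : set R) (x : R) : measurable C ->
  prob P (X j @^-1` C `&` [set w | x <= S j w]) =
  prob P (X 0%N @^-1` C) * prob P [set w | x <= S j w].
Proof.
move=> mC.
have mx : measurable [set w | x <= S j w] by exact: measurable_geR.
rewrite -(iid_prob hid j mC); apply: EFin_inj; rewrite EFinM !probE//.
- have mI : measurable (`[x, +oo[%classic : set R) by exact: measurable_itv.
  have := indep_sum_others hind j mg mC mI.
  rewrite (_ : [set w | _] = [set w | x <= S j w])//.
  by apply/seteqP; split => w /=; rewrite in_itv/= andbT.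
- exact: (measurable_RV X).
- by apply: measurableI => //; exact: (measurable_RV X).
Qed.

Let h x : R := \1_B x / prob P (X 0%N @^-1` B) - \1_A x / prob P (X 0%N @^-1` A).

Let mh : measurable_fun setT h.
Proof.
apply: measurable_funB; apply: measurable_funM => //; exact: measurable_indic.
Qed.

Let h_bound x : `|h x| <= (prob P (X 0%N @^-1` B))^-1 + (prob P (X 0%N @^-1` A))^-1.
Proof.
apply: le_trans (ler_normB _ _) _.
have i1 (C : set R) : `|\1_C x : R| <= 1.
  by rewrite indicE; case: (_ \in _); rewrite /= ?normr1 ?normr0.
by apply: lerD; rewrite normrM (gtr0_norm (_ : 0 < _^-1)) ?invr_gt0//;
  apply: ler_piMl => //; rewrite invr_ge0 ltW.
Qed.

Let integ_h2 : integ (fun w => h (X 0%N w) ^+ 2).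
Proof.
pose M := (prob P (X 0%N @^-1` B))^-1 + (prob P (X 0%N @^-1` A))^-1.
apply: (@le_integrableR _ _ _ _ _ (fun=> M ^+ 2)); last exact: integrable_cstR.
  by apply: measurable_funX; exact: (measurable_comp_RV X).
move=> w; rewrite normrX lerXn2r// ?nnegrE//.
exact: le_trans (normr_ge0 _) (h_bound 0).
Qed.

(** Each indicator is divided by its own mean. Centering keeps the second moment of the sum of the
    [h (X j)] linear in [n]. *)
Let h0 : \int[P]_w h (X 0%N w) = 0.
Proof.
have E (C : set R) : measurable C -> integ (fun w => \1_C (X 0%N w) : R) /\
    \int[P]_w (\1_C (X 0%N w)) = prob P (X 0%N @^-1` C).
  move=> mC; have mXC := measurable_RV X 0 mC.
  by split; [exact: integrable_indicR mXC | rewrite -(Rintegral_indic P mXC)].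
have [iA eA] := E A mA; have [iB eB] := E B mB.
rewrite /h RintegralB//; last 2 first.
- by under eq_fun do rewrite mulrC; exact: integrable_mulRl.
- by under eq_fun do rewrite mulrC; exact: integrable_mulRl.
by rewrite !RintegralZr// eA eB !divff ?subrr// gt_eqF.
Qed.

(* [h (X j)] is the likelihood ratio of forcing [X j] into [B] minus that of
   forcing it into [A]: exchanging the two moves the sum by at least [b - a]. *)
Let interval_le n (j : 'I_n) x :
  prob P [set w | x <= S j w < x + (b - a)] <=
  \int[P]_w (\1_[set w | x + b <= \sum_(i < n) g (X i w)] w * h (X j w)).
Proof.
set U := [set w | x + b <= _].
have mSn : measurable_fun setT (fun w => \sum_(i < n) g (X i w)).
  by apply: measurable_sum => i; exact: (measurable_comp_RV X).
have mU : measurable U by exact: measurable_geR.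
have E (C : set R) : measurable C ->
    integ (fun w => \1_(X j @^-1` C `&` U) w : R) /\
    \int[P]_w (\1_(X j @^-1` C `&` U) w) = prob P (X j @^-1` C `&` U).
  move=> mC; have mXC : measurable (X j @^-1` C `&` U).
    by apply: measurableI => //; exact: (measurable_RV X).
  by split; [exact: integrable_indicR mXC | exact: Rintegral_indic].
have [iA eA] := E A mA; have [iB eB] := E B mB.
set qA := prob P (X 0%N @^-1` A); set qB := prob P (X 0%N @^-1` B).
have SE w : \sum_(i < n) g (X i w) = g (X j w) + S j w by rewrite (bigD1 j).
rewrite (_ : (fun w => _) = fun w =>
    qB^-1 * \1_(X j @^-1` B `&` U) w - qA^-1 * \1_(X j @^-1` A `&` U) w).
  rewrite RintegralB//; [|exact: integrable_mulRl|exact: integrable_mulRl].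
  rewrite !RintegralZl// eA eB.
  have m1 : measurable [set w | x <= S j w] by exact: measurable_geR.
  have m2 : measurable [set w | x + (b - a) <= S j w] by exact: measurable_geR.
  have m3 : measurable [set w | x <= S j w < x + (b - a)].
    rewrite (_ : [set w | _] = [set w | x <= S j w] `&` ~` [set w | x + (b - a) <= S j w]).
      by apply: measurableI => //; exact: measurableC.
    apply/seteqP; split => w /=; first by move=> /andP[-> /lt_geF ->].
    by move=> [-> /negP]; rewrite -ltNge.
  have -> : prob P [set w | x <= S j w < x + (b - a)] =
      prob P [set w | x <= S j w] - prob P [set w | x + (b - a) <= S j w].
    apply/eqP; rewrite -subr_eq opprK; apply/eqP.
    apply: EFin_inj; rewrite EFinD !probE// -measureU//.
      congr (P _); apply/seteqP; split => w /=.
        by move=> [/andP[]//|]; apply: le_trans; rewrite lerDl subr_ge0 ltW.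
      by move=> ->; case: ltP; [left|right].
    apply/seteqP; split => w //= [/andP[_]] /lt_geF ->.
    by [].
  (* If [X j] lies in [B], then [S j >= x] forces the full sum above [x + b]; if it lies in [A], a
     full sum above [x + b] forces [S j >= x + (b - a)]. Independence of [X j] and [S j] turns both
     inclusions into the two bounds. *)
  apply: lerB.
    rewrite mulrC ler_pdivlMr// mulrC -(prob_indep j x mB).
    apply: le_prob; [|by apply: measurableI => //; exact: (measurable_RV X)|].
      by apply: measurableI => //; exact: (measurable_RV X).
    move=> w /= [Bw Sw]; split => //; rewrite /U /= SE addrC lerD//; exact: gB.
  rewrite mulrC ler_pdivrMr// mulrC -(prob_indep j _ mA).
  apply: le_prob; [by apply: measurableI => //; exact: (measurable_RV X)| |].
    by apply: measurableI => //; exact: (measurable_RV X).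
  move=> w /= [Aw]; rewrite /U /= SE => Uw; split => //.
  by have := gA Aw; lra.
apply/funext => w; rewrite /h !indicI /= -/qA -/qB.
by rewrite !indicE /=; case: (_ \in U); rewrite ?mulr1 ?mulr0 ?mul0r ?mul1r ?subrr// mulrC [\1_A _ / _]mulrC.
Qed.

(** Summing [interval_le] over [j] leaves the mean of [1_U H], where [H] is the sum of the
    [h (X j)]. This is at most the mean of [|H|], which is of order [sqrt n] because [H] has second
    moment [n] times that of [h (X 0)]. *)
Let eta_bound n x : (0 < n)%N ->
  \sum_(j < n) prob P [set w | x <= S j w < x + (b - a)] <=
  (\int[P]_w h (X 0%N w) ^+ 2 + 1) / 2 * Num.sqrt n%:R.
Proof.
move=> n0; set U := [set w | x + b <= \sum_(i < n) g (X i w)].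
have mSn : measurable_fun setT (fun w => \sum_(i < n) g (X i w)).
  by apply: measurable_sum => i; exact: (measurable_comp_RV X).
have mU : measurable U by exact: measurable_geR.
have [iH eH] := iid_centered_second_moment hind hid n mh integ_h2 h0.
have iUh (j : 'I_n) : integ (fun w => \1_U w * h (X j w)).
  apply: integrable_mulR.
  - exact: measurable_indic.
  - exact: (measurable_comp_RV X).
  - apply: (@le_integrableR _ _ _ _ _ (fun=> 1)); last exact: integrable_cstR.
      by apply: measurable_funX; exact: measurable_indic.
    by move=> w; rewrite indicE; case: (_ \in _); rewrite ?expr1n ?expr0n ?normr1 ?normr0.
  - apply: (@iid_integrable _ _ _ _ _ hid (fun x => h x ^+ 2)) => //.
    exact: measurable_funX.
apply: le_trans (ler_sum _ (fun j _ => interval_le j x)) _.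
rewrite -/U -(@Rintegral_sum _ _ _ P _ _ (fun j : 'I_n => fun w => \1_U w * h (X j w)))//.
set s := Num.sqrt n%:R.
have s0 : 0 < s by rewrite sqrtr_gt0 ltr0n.
have ss : s * s = n%:R by rewrite -expr2 sqr_sqrtr.
have -> : (\int[P]_w h (X 0%N w) ^+ 2 + 1) / 2 * s =
    \int[P]_w ((2 * s)^-1 * (\sum_(i < n) h (X i w)) ^+ 2 + s / 2).
  rewrite RintegralD//; [|exact: integrable_mulRl|exact: integrable_cstR].
  rewrite RintegralZl// eH Rintegral_cstR -ss.
  by field; rewrite gt_eqF.
apply: le_Rintegral => //.
- exact: integrable_sumR.
- apply: integrable_addR; last exact: integrable_cstR.
  exact: integrable_mulRl.
- (* AM-GM: [`|H| <= H^2 / (2 s) + s / 2] *)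
  move=> w _; rewrite -mulr_sumr; set H := \sum_(i < n) h (X i w).
  apply: (@le_trans _ _ `|H|).
    rewrite indicE; case: (_ \in _); rewrite ?mul1r ?mul0r//; exact: ler_norm.
  rewrite -(real_normK (num_real H)) -subr_ge0.
  rewrite (_ : _ - _ = (2 * s)^-1 * (`|H| - s) ^+ 2); last first.
    by field; rewrite gt_eqF.
  by rewrite mulr_ge0 ?sqr_ge0// invr_ge0 mulr_ge0// ltW.
Qed.

Let measurable_between n (j : 'I_n) x y : measurable [set w | x <= S j w < y].
Proof.
rewrite (_ : [set w | _] = [set w | x <= S j w] `&` [set w | S j w < y]).
  by apply: measurableI; [exact: measurable_geR|exact: measurable_ltR].
by apply/seteqP; split => w /= => [/andP[]|[-> ->]].
Qed.

(** A window of length [k (b - a)] is cut into [k] windows of length [b - a]. *)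
Let multi_eta_bound n x k : (0 < n)%N ->
  \sum_(j < n) prob P [set w | x <= S j w < x + (b - a) *+ k] <=
  ((\int[P]_w h (X 0%N w) ^+ 2 + 1) / 2 * Num.sqrt n%:R) *+ k.
Proof.
move=> n0; elim: k => [|k IH].
  rewrite !mulr0n addr0 big1// => j _.
  rewrite (_ : [set w | _] = set0) ?/prob ?measure0//.
  by apply/seteqP; split => w //= /andP[xS /(le_lt_trans xS)]; rewrite ltxx.
rewrite [leRHS]mulrSr.
apply: le_trans (lerD IH (eta_bound (x + (b - a) *+ k) n0)).
rewrite -big_split /=; apply: ler_sum => j _; apply: prob_le_setU => //.
move=> w /=; rewrite mulrSr addrA => /andP[-> ->].
by case: ltP => _; [left|right].
Qed.

(** Averaging: the [n] window probabilities add up to [O((L + 1) sqrt n)], so at least one of them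
    is [O((L + 1) / sqrt n)]. *)
Lemma leave_one_out_anticoncentration : exists2 C : R, 0 <= C &
  forall n x L, (0 < n)%N -> 0 <= L -> exists j : 'I_n,
    prob P [set w | x <= \sum_(i < n | i != j) g (X i w) < x + L] <=
    C * (L + 1) / Num.sqrt n%:R.
Proof.
set D := (\int[P]_w h (X 0%N w) ^+ 2 + 1) / 2.
have D0 : 0 <= D.
  by rewrite divr_ge0// addr_ge0// Rintegral_ge0// => w _; exact: sqr_ge0.
have e0 : 0 < b - a by rewrite subr_gt0.
(* The second factor times [L + 1] bounds the number [k] of windows; [D + 1] in place of [D] makes
   the averaging contradiction strict. *)
exists ((D + 1) * ((b - a)^-1 + 1)).
  by rewrite mulr_ge0// addr_ge0// invr_ge0 ltW.
move=> n x L n0 L0; set s := Num.sqrt n%:R.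
have s0 : 0 < s by rewrite sqrtr_gt0 ltr0n.
have ss : s * s = n%:R by rewrite -expr2 sqr_sqrtr.
(* The successor guarantees that [k] windows of length [b - a] cover length [L]. *)
pose k := (Num.truncn (L / (b - a))).+1.
have kL : L <= (b - a) *+ k.
  rewrite -mulr_natr -ler_pdivrMl// mulrC ltW// truncnS_gt.
  by [].
have k_le : k%:R <= L / (b - a) + 1.
  rewrite -natr1 lerD2r truncn_le.
  by rewrite divr_ge0// ltW.
apply: contrapT => /forallNP hj.
have : \sum_(j < n) prob P [set w | x <= S j w < x + (b - a) *+ k] >
    (D * s) *+ k.
  apply: (@lt_le_trans _ _ (\sum_(j < n) (D + 1) * ((b - a)^-1 + 1) * (L + 1) / s)); last first.
    apply: ler_sum => j _; have /negP := hj j; rewrite -ltNge => /ltW /le_trans; apply.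
    apply: le_prob; [exact: measurable_between|exact: measurable_between|].
    move=> w /= /andP[-> /lt_le_trans]; apply.
    by rewrite lerD2l.
  rewrite sumr_const card_ord -[X in _ < X]mulr_natr -ss.
  rewrite (_ : _ * (s * s) = (D + 1) * ((b - a)^-1 + 1) * (L + 1) * s); last first.
    by field; rewrite !gt_eqF.
  rewrite -[X in X < _]mulr_natr mulrAC ltr_pM2r//.
  apply: (@lt_le_trans _ _ ((D + 1) * k%:R)).
    by rewrite ltr_pM2r ?ltrDl// ltr0n.
  rewrite -mulrA ler_wpM2l ?addr_ge0//; apply: le_trans k_le _.
  have : 0 <= (b - a)^-1 by rewrite invr_ge0 ltW.
  by nra.
by rewrite ltNge multi_eta_bound.
Qed.

End anticoncentration.

(** * Gaussian estimates *)

Section standard_normal.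
Context (R : realType).
Local Notation mu := (@lebesgue_measure R).
Local Notation nu := (@normal_prob R 0 1).

(** The change of variables holds for the Radon-Nikodym derivative, which equals the density almost
    everywhere since both have the same integral over every measurable set. *)
Lemma ge0_integral_normal_prob (f : R -> \bar R) : measurable_fun setT f ->
  (forall x, 0 <= f x)%E ->
  (\int[nu]_x f x = \int[mu]_x (f x * (normal_pdf 0 1 x)%:E))%E.
Proof.
move=> mf f0; have nm := @normal_prob_dominates R 0 1.
rewrite -(Radon_Nikodym_SigmaFinite.change_of_variables nm)//.
have iRN := Radon_Nikodym_SigmaFinite.f_integrable nm.
have mpdf : measurable_fun setT (fun x : R => (normal_pdf 0 1 x)%:E).
  by apply/measurable_EFinP; exact: measurable_normal_pdf.
apply: ae_eq_integral => //.
- by apply: emeasurable_funM => //; exact: measurable_int iRN.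
- exact: emeasurable_funM.
- apply: ae_eqe_mul2l => /=; apply: integral_ae_eq => //=.
  by move=> E _ mE; rewrite -(Radon_Nikodym_SigmaFinite.f_integral nm).
Qed.

Lemma normal_pdf01E x : normal_pdf 0 1 x = normal_peak 1 * expR (- (x ^+ 2 / 2)) :> R.
Proof.
by rewrite normal_pdfE ?oner_neq0// /normal_fun subr0 expr1n mulNr.
Qed.

(* The exponent 7/16 must be below 1/2 for integrability, and above 3/8 for the
   tail of [`|eps_0|] at [kappa - a] to be [O(d^(-3/4))] when it is [O(1/d)] at
   [kappa]. *)
Lemma exp_square_normal_pdf : exists2 K : R, 0 < K &
  forall x, expR (7 / 16 * x ^+ 2) * normal_pdf 0 1 x =
            K * normal_pdf 0 (Num.sqrt 8) x.
Proof.
(* Since [1/2 - 7/16 = 1/16 = 1/(2 * 8)], the product is, up to normalisation, the centered normal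
   density of variance 8. *)
have s8 : Num.sqrt (8 : R) != 0 by rewrite gt_eqF// sqrtr_gt0.
have p8 := normal_peak_gt0 s8.
exists (normal_peak 1 / normal_peak (Num.sqrt 8)).
  by rewrite divr_gt0// normal_peak_gt0// oner_neq0.
move=> x; rewrite normal_pdf01E normal_pdfE// /normal_fun subr0 sqr_sqrtr//.
rewrite [RHS]mulrA divfK ?gt_eqF// mulrCA -expRD; congr (_ * expR _).
by rewrite -[8 *+ 2]mulr_natr; lra.
Qed.

Lemma normal_exp_square_lty :
  (\int[nu]_x (expR (7 / 16 * x ^+ 2))%:E < +oo)%E.
Proof.
have mf : measurable_fun setT (fun x : R => expR (7 / 16 * x ^+ 2)).
  apply: measurableT_comp => //; apply: measurable_funM => //.
rewrite ge0_integral_normal_prob//; last exact/measurable_EFinP.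
have [K K0 EK] := exp_square_normal_pdf.
under eq_integral do rewrite -EFinM EK EFinM.
rewrite integralZl//; last exact: integrable_normal_pdf.
by rewrite integral_normal_pdf mule1 ltry.
Qed.

(** The density is decreasing on this unit interval, hence at least its value at the right end. *)
Lemma normal_prob_itv_ge (t : R) : 0 <= t ->
  ((normal_peak 1 * expR (- ((t + 1) ^+ 2 / 2)))%:E <= nu `[t, (t + 1)%R])%E.
Proof.
move=> t0; rewrite /normal_prob.
have mI : measurable (`[t, t + 1]%classic : set R) by exact: measurable_itv.
apply: (@le_trans _ _ (\int[mu]_(x in `[t, (t + 1)%R])
    (normal_peak 1 * expR (- ((t + 1) ^+ 2 / 2)))%:E)%E).
  rewrite integral_cst//= lebesgue_measure_itv/= lte_fin ltrDl ltr01 -EFinB.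
  by rewrite addrAC subrr add0r mule1.
apply: ge0_le_integral => //.
- by move=> x _; rewrite lee_fin mulr_ge0 ?normal_peak_ge0 ?expR_ge0.
- apply/measurable_EFinP; apply: measurable_funTS; exact: measurable_normal_pdf.
- move=> x /=; rewrite in_itv/= => /andP[tx xt].
  rewrite lee_fin normal_pdf01E ler_wpM2l ?normal_peak_ge0// ler_expR lerN2.
  by rewrite ler_pM2r ?invr_gt0// lerXn2r// nnegrE; lra.
Qed.

End standard_normal.

(** Through this bound, the single exponential moment of the square yields all absolute moments. *)
Lemma powR_le_exp_square (R : realType) (q : R) : 0 < q ->
  exists2 C : R, 0 < C & forall x, `|x| `^ q <= C * expR (7 / 16 * x ^+ 2).
Proof.
(* The bound is [ln y <= y - 1] at [y = c x^2], multiplied by [q / 2]; this [c] makes the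
   coefficient of [x^2] equal to [7/16]. *)
move=> q0; pose c : R := (7 / 16) / (q / 2).
have c0 : 0 < c by rewrite /c divr_gt0 ?divr_gt0.
exists (expR (- (q / 2 * (1 + ln c)))); first exact: expR_gt0.
move=> x; rewrite -expRD.
have [->|x0] := eqVneq x 0; first by rewrite normr0 powR0 ?gt_eqF// expR_ge0.
have nx : 0 < `|x| by rewrite normr_gt0.
rewrite /powR gt_eqF// ler_expR -(real_normK (num_real x)).
have : ln (c * `|x| ^+ 2) <= c * `|x| ^+ 2 - 1.
  have := @le_ln1Dx R (c * `|x| ^+ 2 - 1); rewrite addrCA subrr addr0; apply.
  by rewrite ltrDr mulr_gt0// exprn_gt0.
rewrite lnM ?posrE ?exprn_gt0// lnXn// => h.
have : q / 2 * (ln c + ln `|x| *+ 2) <= q / 2 * (c * `|x| ^+ 2 - 1).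
  by rewrite ler_wpM2l// divr_ge0// ltW.
have -> : q / 2 * (c * `|x| ^+ 2 - 1) = 7 / 16 * `|x| ^+ 2 - q / 2.
  by rewrite /c; field; rewrite gt_eqF.
by rewrite -mulr_natr; lra.
Qed.

(** * Moments and tails of the noise variables *)

Section gaussian.
Context (R : realType) (disp : measure_display) (T : measurableType disp)
  (P : probability T R) (X : nat -> {RV P >-> R}).
Hypothesis hlaw : forall i (A : set R), measurable A ->
  distribution P (X i) A = normal_prob 0 1 A.

Local Notation integ f := (P.-integrable [set: T] (EFin \o f)).

Lemma gaussian_ident i (A : set R) : measurable A ->
  P (X i @^-1` A) = P (X 0%N @^-1` A).
Proof.
move=> mA; have := hlaw i mA; rewrite -(hlaw 0 mA) => h; exact: h.
Qed.

Lemma measurable_exp_square :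
  measurable_fun setT (fun x : R => expR (7 / 16 * x ^+ 2)).
Proof. by apply: measurableT_comp => //; apply: measurable_funM. Qed.

Lemma gaussian_integrable_exp_square :
  integ (fun w => expR (7 / 16 * X 0%N w ^+ 2)).
Proof.
have mf := measurable_exp_square.
have mfE : measurable_fun setT (fun x : R => (expR (7 / 16 * x ^+ 2))%:E).
  exact/measurable_EFinP.
apply/integrableP; split.
  by apply/measurable_EFinP; exact: (measurable_comp_RV X 0 mf).
under eq_integral do rewrite /= ger0_norm ?expR_ge0//.
(* The variable is retyped with values in [measurableTypeR R], so that its pushforward can be
   compared with [normal_prob]. *)
have mX : measurable_fun setT (X 0%N : T -> measurableTypeR R).
  by move=> mT A mA; exact: (@measurable_funPT _ _ _ _ (X 0%N)).
have := @normal_exp_square_lty R.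
rewrite (eq_measure_integral (pushforward P (X 0%N : T -> measurableTypeR R)))//.
  by rewrite ge0_integral_pushforward//; exact/measurable_EFinP.
by move=> A mA _; apply/esym; exact: hlaw.
Qed.

Lemma gaussian_integrable_powR (q : R) : 0 < q ->
  integ (fun w => `|X 0%N w| `^ q).
Proof.
move=> q0; have [C C0 hC] := powR_le_exp_square q0.
apply: (@le_integrableR _ _ _ P _ (fun w => C * expR (7 / 16 * X 0%N w ^+ 2))).
- by apply: (measurableT_comp (measurable_powR q)); exact: measurableT_comp.
- by move=> w; rewrite ger0_norm ?powR_ge0.
- by apply: integrable_mulRl; exact: gaussian_integrable_exp_square.
Qed.

Lemma measurable_abs_ge (t : R) : measurable [set x : R | t <= `|x|].
Proof. by apply: measurable_geR; exact: normr_measurable. Qed.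

(** Exponential Markov inequality applied to the square of the variable. *)
Lemma gaussian_tail_le : exists2 K : R, 0 < K & forall i t, 0 <= t ->
  prob P (X i @^-1` [set x | t <= `|x|]) <= K * expR (- (7 / 16 * t ^+ 2)).
Proof.
have intf := gaussian_integrable_exp_square.
exists (\int[P]_w expR (7 / 16 * X 0%N w ^+ 2) + 1).
  by rewrite ltr_wpDl// Rintegral_ge0// => w _; exact: expR_ge0.
move=> i t t0; have mt := measurable_abs_ge t.
rewrite (iid_prob gaussian_ident i mt).
apply: (@le_trans _ _ (\int[P]_w expR (7 / 16 * X 0%N w ^+ 2) * expR (- (7 / 16 * t ^+ 2)))); last first.
  by rewrite ler_wpM2r ?expR_ge0// lerDl.
rewrite mulrC -RintegralZl//; apply: prob_le_Rintegral.
- exact: measurable_RV.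
- exact: integrable_mulRl.
- by move=> w; rewrite mulr_ge0 ?expR_ge0.
- move=> w /= tX; rewrite -expRD -expR0 ler_expR addrC subr_ge0 ler_wpM2l//.
  by rewrite -(real_normK (num_real (X 0%N w))) lerXn2r ?nnegrE.
Qed.

Lemma gaussian_itv_ge (t : R) : 0 <= t ->
  normal_peak 1 * expR (- ((t + 1) ^+ 2 / 2)) <= prob P (X 0%N @^-1` `[t, t + 1]).
Proof.
move=> t0; rewrite -lee_fin probE; last by exact: measurable_RV.
have mI : measurable (`[t, t + 1]%classic : set R) by exact: measurable_itv.
by have := hlaw 0%N mI; rewrite /distribution /pushforward => ->; exact: normal_prob_itv_ge.
Qed.

Lemma gaussian_tail_ge (t : R) : 0 <= t ->
  normal_peak 1 * expR (- ((t + 1) ^+ 2 / 2)) <=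
  prob P (X 0%N @^-1` [set x | t <= `|x|]).
Proof.
move=> t0; apply: le_trans (gaussian_itv_ge t0) _; apply: le_prob.
- exact: measurable_RV.
- by apply: measurable_RV; exact: measurable_abs_ge.
- move=> w /=; rewrite in_itv/= => /andP[tX _].
  by rewrite (le_trans tX)// ler_norm.
Qed.

Lemma gaussian_small_gt0 : 0 < prob P (X 0%N @^-1` [set x | `|x| <= 1]).
Proof.
have mI : measurable [set x : R | `|x| <= 1].
  by apply: measurable_leR; exact: normr_measurable.
apply: (@lt_le_trans _ _ (prob P (X 0%N @^-1` `[0, 0 + 1]))).
  apply: lt_le_trans (gaussian_itv_ge (lexx 0)).
  by rewrite mulr_gt0 ?expR_gt0// normal_peak_gt0// oner_neq0.
apply: le_prob; [exact: measurable_RV|exact: measurable_RV|].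
by move=> w /=; rewrite in_itv/= add0r => /andP[X0 X1]; rewrite ger0_norm.
Qed.

End gaussian.

(** * Norm-based tests *)

Section norm_tests.
Context (R : realType) (disp : measure_display) (T : measurableType disp)
  (P : probability T R) (X : nat -> {RV P >-> R}).
Implicit Types (q : \bar R) (kappa : nat -> R).

Definition rejection q (k : R) d (theta : 'rV[R]_d) : set T :=
  [set w | k <= pnorm q (theta + noise X d w)%R].

Lemma shifted_noiseE d (theta : 'rV[R]_d) w (i : 'I_d) :
  (theta + noise X d w)%R ord0 i = theta ord0 i + X i w.
Proof. by rewrite !mxE. Qed.

Lemma measurable_pnorm_shift q d (theta : 'rV[R]_d) :
  measurable_fun setT (fun w => pnorm q (theta + noise X d w)%R).
Proof.
have mn (i : 'I_d) : measurable_fun setT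
    (fun w => `|(theta + noise X d w)%R ord0 i|).
  apply: measurableT_comp => //; under eq_fun do rewrite shifted_noiseE.
  exact: measurable_funD.
case: q => [r| |] /=.
- apply: (measurableT_comp (measurable_powR _)).
  apply: measurable_sum => i.
  exact: (measurableT_comp (measurable_powR _)).
- rewrite /pnorm; elim: (index_enum 'I_d) => [|i s ih].
    by under eq_fun do rewrite big_nil; exact: measurable_cst.
  by under eq_fun do rewrite big_cons; exact: measurable_maxr.
- exact: measurable_cst.
Qed.

Lemma measurable_rejection q k d (theta : 'rV[R]_d) : measurable (rejection q k theta).
Proof. by apply: measurable_geR; exact: measurable_pnorm_shift. Qed.

Lemma expectation_norm_test q kappa d (theta : 'rV[R]_d) :
  'E_P[fun w => norm_test q kappa d (theta + noise X d w)%R]%E =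
  (prob P (rejection q (kappa d) theta))%:E.
Proof.
rewrite probE; last exact: measurable_rejection.
rewrite -expectation_indic; last exact: measurable_rejection.
by congr expectation; apply/funext => w; rewrite /= /norm_test_fun !indicE !in_setE.
Qed.

Lemma asymptotic_size_cvg q kappa alpha :
  asymptotic_size X (norm_test q kappa) alpha ->
  prob P (rejection q (kappa d) (0 : 'rV[R]_d)) @[d --> \oo] --> alpha.
Proof.
move=> h; apply: fine_cvg.
rewrite [X in X @ _ --> _](_ : _ = fun d =>
  'E_P[fun w => norm_test q kappa d (noise X d w)]%E); first exact: h.
apply/funext => d.
rewrite -[LHS]probE; last exact: measurable_rejection.
rewrite -expectation_norm_test; congr expectation.
by apply/funext => w; rewrite add0r.
Qed.

Lemma consistency_setP q kappa (theta : triangular_array R) :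
  consistency_set X (norm_test q kappa) theta <->
  prob P (rejection q (kappa d) (theta d)) @[d --> \oo] --> (1 : R).
Proof.
rewrite /consistency_set /=.
under eq_fun do rewrite expectation_norm_test.
split=> [/fine_cvgP[_ h]|h]; first exact: h.
by apply/fine_cvgP; split; [exact: nearW|exact: h].
Qed.

Lemma consistent_of_le q kappa (theta : triangular_array R) (r : nat -> R) :
  r d @[d --> \oo] --> (0 : R) ->
  (\forall d \near \oo, 1 - r d <= prob P (rejection q (kappa d) (theta d))) ->
  consistency_set X (norm_test q kappa) theta.
Proof.
move=> r0 h; apply/consistency_setP.
apply: (@squeeze_cvgr _ _ _ _ (fun d => 1 - r d) (fun=> 1)).
- near=> d; apply/andP; split; first by near: d.
  by apply: prob_le1; exact: measurable_rejection.
- rewrite -[X in _ --> X]subr0; apply: cvgB => //; exact: cvg_cst.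
- exact: cvg_cst.
Unshelve. all: by end_near. Qed.

(** In the limit the rejection probability under [theta] is at most [alpha + 0 < 1]. *)
Lemma not_consistent_of_le q kappa alpha (theta : triangular_array R) (r : nat -> R) :
  prob P (rejection q (kappa d) (0 : 'rV[R]_d)) @[d --> \oo] --> alpha ->
  alpha < 1 -> r d @[d --> \oo] --> (0 : R) ->
  (\forall d \near \oo, prob P (rejection q (kappa d) (theta d)) <=
    prob P (rejection q (kappa d) (0 : 'rV[R]_d)) + r d) ->
  ~ consistency_set X (norm_test q kappa) theta.
Proof.
move=> ha a1 r0 h /consistency_setP h1.
have : 1 <= alpha + 0.
  apply: ler_cvg_to h1 _ h; exact: cvgD.
by rewrite addr0 leNgt a1.
Qed.

End norm_tests.

(** * The scale [d^(1/8)] *)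

Section growth_scale.
Context (R : realType).

(** The eighth root as an iterated square root. All rates become integer powers of it: the eighth
    power is [d], the fourth [sqrt d], the fifth the block length. *)
Definition root8 (d : nat) : R := Num.sqrt (Num.sqrt (Num.sqrt d%:R)).

Lemma root8_exp8 d : root8 d ^+ 8 = d%:R.
Proof.
by rewrite (exprM _ 2 4) (exprM _ 2 2) /root8 !sqr_sqrtr.
Qed.

Lemma root8_exp4 d : root8 d ^+ 4 = Num.sqrt d%:R.
Proof. by rewrite (exprM _ 2 2) /root8 !sqr_sqrtr. Qed.

Lemma root8_ge0 d : 0 <= root8 d.
Proof. exact: sqrtr_ge0. Qed.

Lemma root8_cvgy : root8 d @[d --> \oo] --> +oo.
Proof.
apply/cvgryPge => M; near=> d.
have M0 : 0 <= `|M| by [].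
apply: le_trans (ler_norm M) _.
rewrite -(@ler_pXn2r _ 8)// ?nnegrE ?root8_ge0// root8_exp8.
by near: d; exact: nbhs_infty_ger.
Unshelve. all: by end_near. Qed.

Lemma near_root8_ge (M : R) : \forall d \near \oo, M <= root8 d.
Proof. by have /cvgryPge := root8_cvgy; exact. Qed.

Lemma cvg_div_root8 (C : R) : C / root8 d @[d --> \oo] --> 0.
Proof.
rewrite -[X in _ --> X](mulr0 C); apply: cvgMr.
by apply/gtr0_cvgV0; [near=> d; apply: (@lt_le_trans _ _ 1) => //; near: d;
  exact: near_root8_ge | exact: root8_cvgy].
Unshelve. all: by end_near. Qed.

End growth_scale.

(** * Norm thresholds expressed coordinatewise *)

Section pnorm_theory.
Context (R : realType).

Lemma pnorm_ge0 (q : \bar R) d (x : 'rV[R]_d) : 0 <= pnorm q x.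
Proof.
case: q => [r| |] //=; first exact: powR_ge0.
by elim/big_ind : _ => // a b a0 b0; rewrite le_max a0.
Qed.

(** The map [t |-> t^p] is increasing on nonnegative reals for every [p > 0], so power sums replace
    norms and [p < 1] requires no separate treatment. *)
Lemma le_pnormE (p k : R) d (x : 'rV[R]_d) : 0 < p -> 0 < k ->
  (k <= pnorm p%:E x) = (k `^ p <= \sum_(i < d) `|x ord0 i| `^ p).
Proof.
move=> p0 k0 /=; set S := \sum_(i < d) _.
have S0 : 0 <= S by apply: sumr_ge0 => i _; exact: powR_ge0.
have pV0 : 0 <= p^-1 by rewrite invr_ge0 ltW.
apply/idP/idP => h.
  have := @ge0_ler_powR R p (ltW p0) k (S `^ p^-1).
  rewrite -powRrM mulVf ?gt_eqF// powRr1//; apply => //.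
    by rewrite nnegrE ltW.
  by rewrite nnegrE powR_ge0.
have := @ge0_ler_powR R _ pV0 (k `^ p) S.
rewrite -powRrM mulfV ?gt_eqF// (powRr1 (ltW k0)); apply => //.
by rewrite nnegrE powR_ge0.
Qed.

(** For [k > 0] the initial value 0 of the maximum cannot reach the threshold, so some coordinate
    does. *)
Lemma le_pnorm_ooP (k : R) d (x : 'rV[R]_d) : 0 < k ->
  reflect (exists i : 'I_d, k <= `|x ord0 i|) (k <= pnorm +oo%E x).
Proof.
move=> k0 /=; apply: (iffP idP) => [kM|[i ki]]; last first.
  exact: le_trans ki (le_bigmax _ (fun i => `|x ord0 i|) i).
apply: contrapT => /forallNP h; move: kM; rewrite leNgt => /negP; apply.
by apply: bigmax_lt => // i _; rewrite ltNge; apply/negP.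
Qed.

End pnorm_theory.

(** * Comparison of the two tests under Gaussian noise *)

Section gaussian_norm_tests.
Context (R : realType) (disp : measure_display) (T : measurableType disp)
  (P : probability T R) (X : nat -> {RV P >-> R}).
Hypothesis hX : iid_standard_normal X.

Let hlaw := hX.1.
Let hind := hX.2.
Let hid := gaussian_ident hlaw.

Local Notation integ f := (P.-integrable [set: T] (EFin \o f)).
Local Notation size0 q kappa d := (prob P (rejection X q (kappa d) (0 : 'rV[R]_d))).

(** Norms are nonnegative, so a critical value [<= 0] would mean rejection with probability 1. *)
Lemma near_critical_gt0 (q : \bar R) (kappa : nat -> R) alpha :
  size0 q kappa d @[d --> \oo] --> alpha -> alpha < 1 ->
  \forall d \near \oo, 0 < kappa d.
Proof.
move=> h a1; near=> d.
have : size0 q kappa d < 1 by near: d; exact: (cvgr_lt _ h _ a1).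
apply: contraTT.
rewrite -!leNgt => k0; rewrite (_ : rejection _ _ _ _ = setT).
  by rewrite /prob probability_setT.
by apply/seteqP; split => // w _; rewrite /rejection /= (le_trans k0)// pnorm_ge0.
Unshelve. all: by end_near. Qed.

Lemma measurable_powabs (p : R) : measurable_fun setT (fun x : R => `|x| `^ p).
Proof. by apply: (measurableT_comp (measurable_powR p)); exact: normr_measurable. Qed.

Lemma measurable_powabs_ge (p y : R) : measurable [set x : R | y <= `|x| `^ p].
Proof. by apply: measurable_geR; exact: measurable_powabs. Qed.

(** Markov's inequality for the ninth power of [|X i|^p]. For [y] of order [s = d^(1/8)] the bound
    is of order [s^-9], which beats the factor [d = s^8] of a union bound. *)
Lemma gaussian_powR_tail (p : R) : 0 < p -> exists2 K : R, 0 < K &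
  forall i y, 0 < y ->
    prob P (X i @^-1` [set x | y <= `|x| `^ p]) <= K / y ^+ 9.
Proof.
move=> p0; have p90 : 0 < p * 9 by rewrite mulr_gt0.
have intf := gaussian_integrable_powR hlaw p90.
exists (\int[P]_w `|X 0%N w| `^ (p * 9) + 1).
  by rewrite ltr_wpDl// Rintegral_ge0// => w _; exact: powR_ge0.
move=> i y y0; have my := measurable_powabs_ge p y.
rewrite (iid_prob hid i my).
have y90 : 0 < y ^+ 9 by rewrite exprn_gt0.
apply: (@le_trans _ _ ((\int[P]_w `|X 0%N w| `^ (p * 9)) / y ^+ 9)); last first.
  by rewrite ler_wpM2r ?invr_ge0 ?(ltW y90)// lerDl.
rewrite mulrC -RintegralZl//; apply: prob_le_Rintegral.
- exact: measurable_RV.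
- exact: integrable_mulRl.
- by move=> w; rewrite mulr_ge0 ?powR_ge0// invr_ge0 ltW.
- move=> w /= yX; rewrite mulrC ler_pdivlMr// mul1r powRrM powR_mulrn ?powR_ge0//.
  by rewrite lerXn2r// nnegrE ?powR_ge0// ltW.
Qed.

Lemma rejection_oo_le (k : R) d : 0 < k ->
  prob P (rejection X +oo%E k (0 : 'rV[R]_d)) <=
  d%:R * prob P (X 0%N @^-1` [set x | k <= `|x|]).
Proof.
move=> k0; have mk := measurable_abs_ge k.
apply: le_trans (@prob_le_bigU _ _ _ P _ d (fun i => X i @^-1` [set x | k <= `|x|]) _ _ _) _.
- exact: measurable_rejection.
- by move=> i; exact: measurable_RV.
- move=> w; rewrite /rejection /= => /le_pnorm_ooP-/(_ k0)[i].
  rewrite shifted_noiseE mxE add0r => ki.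
  by rewrite -(bigcup_mkord d (fun i => X i @^-1` [set x | k <= `|x|])); exists i => /=.
- under eq_bigr do rewrite (iid_prob hid _ mk).
  by rewrite sumr_const card_ord mulr_natl.
Qed.


Lemma rejectionP (p k : R) d (theta : 'rV[R]_d) w : 0 < p -> 0 < k ->
  rejection X p%:E k theta w <->
  k `^ p <= \sum_(i < d) `|(theta + noise X d w)%R ord0 i| `^ p.
Proof.
by move=> p0 k0; rewrite /rejection /mkset (le_pnormE _ p0 k0).
Qed.

Lemma gaussian_big_gt0 (t : R) : 0 <= t ->
  0 < prob P (X 0%N @^-1` [set x | t <= `|x|]).
Proof.
move=> t0; apply: lt_le_trans (gaussian_tail_ge hlaw t0).
by rewrite mulr_gt0 ?expR_gt0// normal_peak_gt0// oner_neq0.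
Qed.

(** The sets [|x| <= 1] and [2 <= |x|] both have positive probability, and [|x|^p] is at most [1] on
    the first and at least [2^p > 1] on the second. *)
Lemma gaussian_powR_anticoncentration (p : R) : 0 < p -> exists2 C : R, 0 <= C &
  forall n x L, (0 < n)%N -> 0 <= L -> exists j : 'I_n,
    prob P [set w | x <= \sum_(i < n | i != j) `|X i w| `^ p < x + L] <=
    C * (L + 1) / Num.sqrt n%:R.
Proof.
move=> p0.
have mA : measurable [set x : R | `|x| <= 1].
  by apply: measurable_leR; exact: normr_measurable.
have p1 : (1 : R) `^ p = 1 by rewrite powR1.
have gA (x : R) : [set x : R | `|x| <= 1] x -> `|x| `^ p <= 1.
  move=> x1; rewrite -[leRHS]p1; apply: ge0_ler_powR => //; first exact: ltW.
  by rewrite nnegrE.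
have gB (x : R) : [set x : R | 2 <= `|x|] x -> 2 `^ p <= `|x| `^ p.
  move=> x2; apply: ge0_ler_powR; [exact: ltW| | |exact: x2]; by rewrite nnegrE.
have ab : (1 : R) < 2 `^ p.
  rewrite -[ltLHS]p1; apply: gt0_ltr_powR => //; rewrite ?nnegrE//.
  by rewrite ltr1n.
apply: (leave_one_out_anticoncentration hind hid (measurable_powabs p) mA
  (measurable_abs_ge 2) gA gB ab).
  exact: gaussian_small_gt0.
by apply: gaussian_big_gt0.
Qed.

(** * The spike *)

Lemma spike_sum_le (p c : R) d (theta : 'rV[R]_d) (j : 'I_d) w : 0 < p -> 0 <= c ->
    theta ord0 j = c -> (forall i, i != j -> theta ord0 i = 0) ->
    `|X j w| <= c ->
  \sum_(i < d) `|(theta + noise X d w)%R ord0 i| `^ p <=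
  \sum_(i < d | i != j) `|X i w| `^ p + (2 * c) `^ p.
Proof.
move=> p0 c0 tj ti Xc; rewrite (bigD1 j)//= addrC; apply: lerD.
  by apply: ler_sum => i ij; rewrite shifted_noiseE ti// add0r.
apply: ge0_ler_powR; [exact: ltW|by rewrite nnegrE|by rewrite nnegrE mulr_ge0|].
rewrite shifted_noiseE tj (le_trans (ler_normD _ _))// ger0_norm//.
by move: Xc; lra.
Qed.

Lemma spike_separates (p : R) (kappa_p kappa_oo : nat -> R) (alpha_p alpha_oo : R) :
    0 < p ->
    size0 p%:E kappa_p d @[d --> \oo] --> alpha_p -> alpha_p < 1 ->
    size0 +oo%E kappa_oo d @[d --> \oo] --> alpha_oo -> 0 < alpha_oo < 1 ->
  exists2 theta : triangular_array R,
    consistency_set X (norm_test +oo%E kappa_oo) theta &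
    ~ consistency_set X (norm_test p%:E kappa_p) theta.
Proof.
move=> p0 hp ap1 hoo /andP[aoo0 aoo1].
have [C C0 anti] := gaussian_powR_anticoncentration p0.
have [K K0 tail] := gaussian_powR_tail p0.
pose s := @root8 R.
(* The height for which [(2 c)^p = s]. *)
pose c d := s d `^ p^-1 / 2.
pose S d (j : 'I_d) w := \sum_(i < d | i != j) `|X i w| `^ p.
(* The spike position is the index provided by anticoncentration for the window of length [s] just
   below [kappa_p^p]. For [d = 0] there is no index, and the zero vector is a placeholder. *)
have spike d : exists theta : 'rV[R]_d, (0 < d)%N -> exists j : 'I_d,
    [/\ theta ord0 j = c d, forall i, i != j -> theta ord0 i = 0 &
      prob P [set w | kappa_p d `^ p - s d <= S d j w < kappa_p d `^ p - s d + s d] <=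
      C * (s d + 1) / Num.sqrt d%:R].
  case: d => [|d]; first by exists 0.
  have [j hj] := anti d.+1 (kappa_p d.+1 `^ p - s d.+1) (s d.+1) isT (root8_ge0 _ _).
  exists (\row_i (if i == j then c d.+1 else 0)) => _; exists j; split => //.
    by rewrite mxE eqxx.
  by move=> i /negbTE ij; rewrite mxE ij.
pose theta d := projT1 (cid (spike d)).
have thetaP d : (0 < d)%N -> exists j : 'I_d,
    [/\ theta d ord0 j = c d, forall i, i != j -> theta d ord0 i = 0 &
      prob P [set w | kappa_p d `^ p - s d <= S d j w < kappa_p d `^ p - s d + s d] <=
      C * (s d + 1) / Num.sqrt d%:R].
  exact: projT2 (cid (spike d)).
(* From [c / 2 = s^(1/p) / 4] one gets [(c / 2)^p = s e]. *)
pose e : R := 4^-1 `^ p.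
have e0 : 0 < e by rewrite powR_gt0.
pose M := K / e ^+ 9.
have M0 : 0 < M by rewrite divr_gt0// exprn_gt0.
have sV d : 1 <= s d -> (s d `^ p^-1) `^ p = s d.
  by move=> s1; rewrite -powRrM mulVf ?gt_eqF// powRr1// root8_ge0.
have c2 d : 1 <= s d -> (2 * c d) `^ p = s d.
  by move=> s1; rewrite /c mulrC divfK// sV.
have c0 d : 0 <= c d by rewrite divr_ge0// powR_ge0.
have ch d : 1 <= s d -> (c d / 2) `^ p = s d * e.
  move=> s1; rewrite -{1}(sV d s1) /e -powRM ?powR_ge0//.
  by congr powR; rewrite /c; field.
have d0 d : 1 <= s d -> (0 < d)%N.
  by case: d => //; rewrite /s /root8 !sqrtr0 ler10.
(* Here [d = s^8] meets the tail [K / (s e)^9], leaving [M / s]. *)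
have ctail i d : 1 <= s d ->
    d%:R * prob P (X i @^-1` [set x | c d / 2 <= `|x|]) <= M / s d.
  move=> s1; have s0 : 0 < s d by exact: lt_le_trans s1.
  have se0 : 0 < s d * e by rewrite mulr_gt0.
  rewrite -(root8_exp8 R d) -/(s d).
  apply: (@le_trans _ _ (s d ^+ 8 * (K / (s d * e) ^+ 9))).
    rewrite ler_wpM2l ?exprn_ge0 ?(ltW s0)//; apply: le_trans (tail i _ se0).
    apply: le_prob.
    - by apply: measurable_RV; exact: measurable_abs_ge.
    - by apply: measurable_RV; exact: measurable_powabs_ge.
    - move=> w /= cX; rewrite -(ch d s1); apply: ge0_ler_powR; [exact: ltW| | |exact: cX].
        by rewrite nnegrE divr_ge0.
      by rewrite nnegrE.
  have E u v t : u != 0 -> v != 0 -> t != 0 -> u * (K / (t * u * v)) = K / v / t.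
    by move=> *; field; apply/and3P; split.
  rewrite exprMn (exprS (s d) 8) E ?expf_neq0 ?gt_eqF//.
have ctail1 i d : 1 <= s d -> prob P (X i @^-1` [set x | c d / 2 <= `|x|]) <= M / s d.
  move=> s1; apply: le_trans (ctail i d s1).
  by rewrite ler_peMl ?prob_ge0// ler1n d0.
exists theta.
  apply: (@consistent_of_le _ _ _ _ _ _ _ _ (fun d => M / s d)).
    exact: cvg_div_root8.
  near=> d.
  have s1 : 1 <= s d by near: d; exact: near_root8_ge.
  have koo0 : 0 < kappa_oo d by near: d; exact: near_critical_gt0 hoo aoo1.
  have [j [tj _ _]] := thetaP d (d0 d s1).
  (* Otherwise the union bound would make the size at most [M / s], which tends to 0, against
     [alpha_oo > 0]. *)
  have kc : kappa_oo d < c d / 2.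
    rewrite ltNge; apply/negP => ck.
    have : size0 +oo%E kappa_oo d <= M / s d.
      apply: le_trans (rejection_oo_le _ koo0) _; apply: le_trans (ctail 0%N d s1).
      rewrite ler_wpM2l//; apply: le_prob.
      - by apply: measurable_RV; exact: measurable_abs_ge.
      - by apply: measurable_RV; exact: measurable_abs_ge.
      - by move=> w /=; exact: le_trans.
    apply/negP; rewrite -ltNge; apply: (@lt_trans _ _ (alpha_oo / 2)).
      near: d; apply: (cvgr_lt 0); first exact: cvg_div_root8.
      by rewrite divr_gt0.
    by near: d; apply: (cvgr_gt _ hoo); rewrite gtr_pMr// invf_lt1// ltr1n.
  rewrite lerBlDr addrC -lerBlDr -prob_setC; last exact: measurable_rejection.
  apply: le_trans (ctail1 j d s1); apply: le_prob.
  - by apply: measurableC; exact: measurable_rejection.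
  - by apply: measurable_RV; exact: measurable_abs_ge.
  - move=> w /=; apply: contra_notP => /negP; rewrite -ltNge => Xj.
    rewrite /rejection /=; apply/(le_pnorm_ooP _ koo0); exists j.
    rewrite shifted_noiseE tj (le_trans (ltW kc))//.
    have := ler_normB (c d + X j w) (X j w); rewrite addrK ger0_norm//.
    by lra.
(* The term [2 C] comes from [C (s + 1) / s^4 <= 2 C / s], valid for [s >= 1]; the term [M] from the
   event [|X j| >= c / 2]. *)
apply: (@not_consistent_of_le _ _ _ _ _ _ _ alpha_p _ (fun d => (2 * C + M) / s d) hp ap1).
  exact: cvg_div_root8.
near=> d.
have s1 : 1 <= s d by near: d; exact: near_root8_ge.
have s0 : 0 < s d by exact: lt_le_trans s1.
have kp0 : 0 < kappa_p d by near: d; exact: near_critical_gt0 hp ap1.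
have [j [tj ti hj]] := thetaP d (d0 d s1).
have mS : measurable_fun setT (S d j).
  rewrite /S; under eq_fun do rewrite big_mkcond /=.
  apply: measurable_sum => i; case: (i != j) => //.
  exact: (measurable_comp_RV X _ (measurable_powabs p)).
set B := [set w | _ <= S d j w < _] in hj.
have mB : measurable B.
  rewrite (_ : B = [set w | kappa_p d `^ p - s d <= S d j w] `&`
     [set w | S d j w < kappa_p d `^ p - s d + s d]).
    by apply: measurableI; [exact: measurable_geR|exact: measurable_ltR].
  by apply/seteqP; split => w /= => [/andP[]|[h1 h2]]//; rewrite /B /= h1.
have mt : measurable (X j @^-1` [set x | c d / 2 <= `|x|]).
  by apply: measurable_RV; exact: measurable_abs_ge.
apply: (@le_trans _ _ (size0 p%:E kappa_p d +
    (prob P B + prob P (X j @^-1` [set x | c d / 2 <= `|x|])))).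
  apply: (@le_trans _ _ (size0 p%:E kappa_p d +
      prob P (B `|` X j @^-1` [set x | c d / 2 <= `|x|]))); last first.
    by rewrite lerD2l; apply: prob_le_setU => //; exact: measurableU.
  apply: prob_le_setU.
  - exact: measurable_rejection.
  - exact: measurable_rejection.
  - exact: measurableU.
  (* Three cases: the noise at the spike is large; or the other terms already reach the critical
     value, so the test rejects without signal; or their sum falls short of it by at most [s], which
     is the event [B]. *)
  - move=> w /(rejectionP _ _ p0 kp0) kS.
    have [cX|Xc] := leP (c d / 2) `|X j w|; first by right; right.
    have := @spike_sum_le p (c d) d (theta d) j w p0 (c0 d) tj ti.
    have Xc' : `|X j w| <= c d by have := c0 d; lra.
    move=> /(_ Xc') /(le_trans kS); rewrite (c2 d s1) -/(S d j w) => kSj.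
    have [kSj'|Sk] := leP (kappa_p d `^ p) (S d j w).
      left; apply/(rejectionP _ _ p0 kp0).
      apply: le_trans kSj' _; rewrite [leRHS](bigD1 j)//= -[leLHS]add0r.
      apply: lerD; first exact: powR_ge0.
      by rewrite le_eqVlt; apply/orP; left; apply/eqP; apply: eq_bigr => i _;
        rewrite shifted_noiseE mxE add0r.
    right; left; rewrite /B /= subrK Sk andbT.
    by rewrite lerBlDr.
rewrite lerD2l mulrDl; apply: lerD; last exact: ctail1.
apply: le_trans hj _; rewrite -root8_exp4 -/(s d).
rewrite ler_pdivrMr ?exprn_gt0//.
rewrite (exprS (s d) 3) mulrA divfK ?gt_eqF// (mulrC 2) -mulrA ler_wpM2l//.
rewrite mulr_natl mulr2n lerD ?exprn_ege1//.
exact: ler_eXnr.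
Unshelve. all: by end_near. Qed.

(** * The block *)

Lemma acceptance_oo (k : R) d : 0 < k ->
  1 - prob P (rejection X +oo%E k (0 : 'rV[R]_d)) =
  (1 - prob P (X 0%N @^-1` [set x | k <= `|x|])) ^+ d.
Proof.
move=> k0; have mk := measurable_abs_ge k.
have mkC := measurableC mk.
rewrite -prob_setC; last exact: measurable_rejection.
rewrite -prob_setC; last exact: measurable_RV.
rewrite (_ : ~` rejection _ _ _ _ =
    \big[setI/setT]_(j <- iota 0 d) (X j @^-1` ~` [set x | k <= `|x|])).
  apply: EFin_inj; rewrite probE; last first.
    by apply: bigsetI_measurable => j _; exact: measurable_RV.
  rewrite (mutually_independent_seq hind (iota_uniq _ _) (fun=> mkC)).
  rewrite (eq_bigr (fun=> (prob P (X 0%N @^-1` ~` [set x | k <= `|x|]))%:E)); last first.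
    by move=> j _; rewrite (hid j mkC) probE//; exact: measurable_RV.
  rewrite prodEFin; congr EFin.
  by rewrite big_const_seq count_predT size_iota iter_mulr_1.
rewrite -bigcap_seq; apply/seteqP; split => w.
  move=> nrej j /=; rewrite mem_iota add0n /= => jd kX; apply: nrej.
  rewrite /rejection /mkset; apply/(le_pnorm_ooP _ k0); exists (Ordinal jd).
  by rewrite shifted_noiseE mxE add0r.
move=> h; rewrite /rejection /setC /mkset => /(le_pnorm_ooP _ k0)[i].
rewrite shifted_noiseE mxE add0r; apply: (h i).
by rewrite /= mem_iota add0n /= ltn_ord.
Qed.

(** With exceedance probability [q], acceptance has probability [(1 - q)^d <= exp(- d q)]. It
    eventually stays above [(1 - alpha) / 2], which bounds [d q]. *)
Lemma near_exceedance_le (kappa : nat -> R) alpha :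
    size0 +oo%E kappa d @[d --> \oo] --> alpha -> alpha < 1 ->
  exists2 C : R, 0 < C & \forall d \near \oo,
    d%:R * prob P (X 0%N @^-1` [set x | kappa d <= `|x|]) <= C.
Proof.
move=> h a1; have e0 : 0 < (1 - alpha) / 2 by rewrite divr_gt0// subr_gt0.
exists (`|ln ((1 - alpha) / 2)| + 1); first by rewrite ltr_wpDl.
near=> d.
have k0 : 0 < kappa d by near: d; exact: near_critical_gt0 h a1.
have : size0 +oo%E kappa d < (1 + alpha) / 2.
  by near: d; apply: (cvgr_lt _ h); rewrite ltr_pdivlMr// mulr_natr mulr2n ltrD2r.
have := acceptance_oo d k0; set q := prob P (X 0%N @^-1` _) => E lt.
have q1 : q <= 1 by apply: prob_le1; apply: measurable_RV; exact: measurable_abs_ge.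
have le : (1 - alpha) / 2 <= expR (- (d%:R * q)).
  apply: (@le_trans _ _ ((1 - q) ^+ d)); first by rewrite -E; lra.
  rewrite -mulrN expRM_natl lerXn2r ?nnegrE ?subr_ge0 ?expR_ge0//.
  exact: expR_ge1Dx.
have : ln ((1 - alpha) / 2) <= - (d%:R * q).
  by rewrite -(expRK (- (d%:R * q))) ler_ln// posrE expR_gt0.
have := ler_norm (- ln ((1 - alpha) / 2)); rewrite normrN; lra.
Unshelve. all: by end_near. Qed.

(** Put [u = exp(- (kappa + 1)^2 / 8)]. The lower Gaussian tail is a multiple of [u^4], so the bound
    on [d q] gives [s^2 u <= B]. The upper tail at [kappa - a] is [O(u^3)], because [7/16 > 3/8],
    and [s^5 u^3 = (s^2 u)^3 / s]. *)
Lemma near_shifted_exceedance_le (kappa : nat -> R) alpha (a : R) : 0 <= a ->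
    size0 +oo%E kappa d @[d --> \oo] --> alpha -> alpha < 1 ->
  exists2 C : R, 0 < C & \forall d \near \oo,
    root8 R d ^+ 5 * prob P (X 0%N @^-1` [set x | kappa d - a <= `|x|]) <= C / root8 R d.
Proof.
move=> a0 h a1; have [C1 C10 near_C1] := near_exceedance_le h a1.
have [K K0 tail] := gaussian_tail_le hlaw.
have peak0 : 0 < @normal_peak R 1 by rewrite normal_peak_gt0// oner_neq0.
(* Adding 1 gives [B > 1], so that [s^2 u > B] would imply
   [(s^2 u)^4 >= s^2 u > C1 / normal_peak 1]. *)
pose B := C1 / normal_peak 1 + 1.
have B1 : 1 < B by rewrite ltrDr divr_gt0.
have B0 : 0 < B by exact: lt_trans B1.
(* The exponent is the maximum over [k] of [3/8 (k + 1)^2 - 7/16 (k - a)^2], attained at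
   [k = 7 a + 6]. *)
pose E := expR (((7 * a + 6) ^+ 2 - 7 * a ^+ 2 + 6) / 16).
have E0 : 0 < E by exact: expR_gt0.
exists (K * E * B ^+ 3); first by rewrite !mulr_gt0// exprn_gt0.
near=> d.
have k0 : 0 < kappa d by near: d; exact: near_critical_gt0 h a1.
have hC1 : d%:R * prob P (X 0%N @^-1` [set x | kappa d <= `|x|]) <= C1.
  by near: d; exact: near_C1.
have s1 : 1 <= root8 R d by near: d; exact: near_root8_ge.
have sB : B * expR ((a + 1) ^+ 2 / 8) + 1 <= root8 R d.
  by near: d; exact: near_root8_ge.
move: (root8_exp8 R d) hC1 s1 sB; set s := root8 R d => s8 hC1 s1 sB.
have s0 : 0 < s by exact: lt_le_trans s1.
pose u := expR (- ((kappa d + 1) ^+ 2 / 8)).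
have u0 : 0 < u by exact: expR_gt0.
have u4 : u ^+ 4 = expR (- ((kappa d + 1) ^+ 2 / 2)).
  by rewrite /u -expRM_natl; congr expR; field.
have u3 : u ^+ 3 = expR (- (3 / 8 * (kappa d + 1) ^+ 2)).
  by rewrite /u -expRM_natl; congr expR; field.
have su : s ^+ 2 * u <= B.
  rewrite leNgt; apply/negP => Bsu.
  have : (s ^+ 2 * u) ^+ 4 <= C1 / normal_peak 1.
    rewrite ler_pdivlMr// exprMn -exprM s8 u4 -mulrA; apply: le_trans hC1.
    rewrite ler_wpM2l// [leLHS]mulrC; exact: (gaussian_tail_ge hlaw (ltW k0)).
  apply/negP; rewrite -ltNge; apply: (@lt_le_trans _ _ B); first by rewrite ltrDl.
  apply: le_trans (ltW Bsu) _; apply: ler_eXnr => //.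
  exact: ltW (lt_trans B1 Bsu).
(* If [kappa < a], then [u] is bounded below, and [s u <= s^2 u <= B] bounds [s], contrary to
   [sB]. *)
have ka : a <= kappa d.
  rewrite leNgt; apply/negP => ka.
  have : expR (- ((a + 1) ^+ 2 / 8)) <= u.
    rewrite ler_expR lerN2 ler_pM2r ?invr_gt0// lerXn2r ?nnegrE//; lra.
  rewrite expRN => hu.
  have : s <= B * expR ((a + 1) ^+ 2 / 8).
    rewrite -ler_pdivrMr ?expR_gt0//; apply: le_trans su.
    apply: (@le_trans _ _ (s * u)); first by rewrite ler_wpM2l// ltW.
    by rewrite ler_wpM2r ?(ltW u0)// ler_eXnr.
  by move: sB; lra.
have ka0 : 0 <= kappa d - a by rewrite subr_ge0.
apply: (@le_trans _ _ (s ^+ 5 * (K * (E * u ^+ 3)))).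
  rewrite ler_wpM2l ?exprn_ge0 ?(ltW s0)//; apply: le_trans (tail 0%N _ ka0) _.
  rewrite ler_wpM2l ?(ltW K0)// u3 -expRD ler_expR.
  by have := sqr_ge0 (kappa d - (7 * a + 6)); nra.
rewrite ler_pdivlMr//.
rewrite (_ : _ * s = K * E * (s ^+ 2 * u) ^+ 3); last by ring.
by rewrite ler_wpM2l ?mulr_ge0 ?(ltW K0) ?(ltW E0)// lerXn2r ?nnegrE// ?mulr_ge0 ?exprn_ge0 ?ltW.
Unshelve. all: by end_near. Qed.

(** For [|x| <= 1] the shifted value is at least [b]; elsewhere its power is only bounded below by
    0. The bracket is thus a lower bound for the gain of one shifted coordinate, with no triangle
    inequality for [p]. *)
Lemma shifted_powabs_ge (p b x : R) : 0 < p -> 0 <= b ->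
  `|x| `^ p + (b `^ p * \1_[set y : R | `|y| <= 1] x - `|x| `^ p) <= `|b + 1 + x| `^ p.
Proof.
move=> p0 b0; rewrite addrC subrK indicE; case: (boolP (x \in _)) => [|_].
  rewrite inE /= mulr1 => x1; apply: ge0_ler_powR; rewrite ?nnegrE ?(ltW p0)//.
  by rewrite (le_trans _ (ler_norm _))//; move: x1; rewrite ler_norml => /andP[]; lra.
by rewrite mulr0 powR_ge0.
Qed.

Lemma gain_integrable_sqr (p b : R) : 0 < p ->
  integ (fun w => (b `^ p * \1_[set y : R | `|y| <= 1] (X 0%N w) - `|X 0%N w| `^ p) ^+ 2).
Proof.
move=> p0; have p20 : 0 < p * 2 by rewrite mulr_gt0.
have mI : measurable [set y : R | `|y| <= 1].
  by apply: measurable_leR; exact: normr_measurable.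
apply: (@le_integrableR _ _ _ P _ (fun w => (b `^ p) ^+ 2 + `|X 0%N w| `^ (p * 2))).
- have mg : measurable_fun setT
      (fun x : R => (b `^ p * \1_[set y : R | `|y| <= 1] x - `|x| `^ p) ^+ 2).
    apply: measurable_funX; apply: measurable_funB; last exact: measurable_powabs.
    by apply: measurable_funM => //; exact: measurable_indic.
  exact: (measurable_comp_RV X 0 mg).
- move=> w; rewrite ger0_norm ?sqr_ge0// powRrM powR_mulrn ?powR_ge0//.
  have Y0 := powR_ge0 `|X 0%N w| p; have B0 := powR_ge0 b p.
  rewrite indicE; case: (_ \in _); rewrite /= ?mulr1 ?mulr0; nra.
- apply: integrable_addR; first exact: integrable_cstR.
  exact: (gaussian_integrable_powR hlaw p20).
Qed.

(** Let [q] be the probability of [|X 0| <= 1] and [m] the mean of [|X 0|^p]. The choice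
    [b^p = (m + 1) / q] makes the mean gain equal to 1. *)
Lemma exists_positive_gain (p : R) : 0 < p -> exists2 b : R, 0 < b &
  0 < \int[P]_w (b `^ p * \1_[set y : R | `|y| <= 1] (X 0%N w) - `|X 0%N w| `^ p).
Proof.
move=> p0; pose m := \int[P]_w `|X 0%N w| `^ p.
have mI : measurable [set y : R | `|y| <= 1].
  by apply: measurable_leR; exact: normr_measurable.
have mXI := measurable_RV X 0 mI.
pose q := prob P (X 0%N @^-1` [set x | `|x| <= 1]).
have q0 : 0 < q by exact: gaussian_small_gt0.
have m0 : 0 <= m by rewrite Rintegral_ge0// => w _; exact: powR_ge0.
pose B := (m + 1) / q.
have B0 : 0 < B by rewrite divr_gt0// ltr_wpDl.
exists (B `^ p^-1); first exact: powR_gt0.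
rewrite -powRrM mulVf ?gt_eqF// powRr1 ?ltW//.
have iI : integ (fun w => \1_[set y : R | `|y| <= 1] (X 0%N w) : R).
  exact: integrable_indicR mXI.
rewrite RintegralB//; last 2 first.
- exact: integrable_mulRl.
- exact: (gaussian_integrable_powR hlaw p0).
rewrite RintegralZl// -/m.
rewrite (_ : \int[P]_w _ = q); last by rewrite /q -(Rintegral_indic P mXI).
by rewrite /B divfK ?gt_eqF// addrAC subrr add0r ltr01.
Qed.

(** Take the integer part of [s^5]: it is at most [s^8 = d], and [s >= 2] makes the rounding loss of
    at most 1 no more than [s^5 / 2]. *)
Lemma block_size (s : R) d : s ^+ 8 = d%:R -> 2 <= s ->
  exists m : nat, [/\ (m <= d)%N, m%:R <= s ^+ 5 & s ^+ 5 / 2 <= m%:R].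
Proof.
move=> s8 s2; have s0 : 0 <= s by lra.
have s1 : 1 <= s by lra.
have s51 : 2 <= s ^+ 5 by apply: le_trans s2 _; apply: ler_eXnr.
exists (Num.truncn (s ^+ 5)); have := truncn_itv (exprn_ge0 5 s0) => /andP[h1 h2].
split => //.
  rewrite -(ler_nat R) (le_trans h1)// -s8; exact: ler_weXn2l.
by move: h2; rewrite -natr1; lra.
Qed.

Lemma sum_shift_ge (p b : R) d m (theta : 'rV[R]_d) w : 0 < p -> 0 <= b -> (m <= d)%N ->
    (forall i, theta ord0 i = if (i < m)%N then b + 1 else 0) ->
  \sum_(i < d) `|X i w| `^ p +
  \sum_(i < m) (b `^ p * \1_[set y : R | `|y| <= 1] (X i w) - `|X i w| `^ p) <=
  \sum_(i < d) `|(theta + noise X d w)%R ord0 i| `^ p.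
Proof.
move=> p0 b0 md th.
rewrite (big_ord_widen d (fun i => b `^ p * \1_[set y : R | `|y| <= 1] (X i w) - `|X i w| `^ p) md).
rewrite [X in _ + X <= _]big_mkcond /= -big_split /=; apply: ler_sum => i _.
rewrite shifted_noiseE th; case: ifP => _; last by rewrite add0r addr0.
exact: shifted_powabs_ge.
Qed.

(** For a noise sum [u] with mean [x] and a block gain [v] with mean [y]: the gain exceeds [2 l],
    and the noise takes back less than [l]. *)
Lemma deviation_le (u v x y l : R) : `|u - x| < l -> `|v - y| < l *+ 2 ->
  l *+ 4 <= y -> x + l <= u + v.
Proof.
rewrite !ltr_norml -!(mulr_natr l) => /andP[h1 _] /andP[h2 _] h3.
by lra.
Qed.

Lemma block_separates (p : R) (kappa_p kappa_oo : nat -> R) (alpha_p alpha_oo : R) :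
    0 < p ->
    size0 p%:E kappa_p d @[d --> \oo] --> alpha_p -> 0 < alpha_p < 1 ->
    size0 +oo%E kappa_oo d @[d --> \oo] --> alpha_oo -> alpha_oo < 1 ->
  exists2 theta : triangular_array R,
    consistency_set X (norm_test p%:E kappa_p) theta &
    ~ consistency_set X (norm_test +oo%E kappa_oo) theta.
Proof.
move=> p0 hp /andP[ap0 ap1] hoo aoo1.
have [b b0 D0] := exists_positive_gain p0.
pose Y (x : R) := `|x| `^ p.
pose Z (x : R) := b `^ p * \1_[set y : R | `|y| <= 1] x - `|x| `^ p.
set D := \int[P]_w _ in D0.
pose mu := \int[P]_w Y (X 0%N w).
have mI : measurable [set y : R | `|y| <= 1].
  by apply: measurable_leR; exact: normr_measurable.
have mY : measurable_fun setT Y by exact: measurable_powabs.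
have mZ : measurable_fun setT Z.
  apply: measurable_funB => //.
  by apply: measurable_funM => //; exact: measurable_indic.
have iZ2 : integ (fun w => Z (X 0%N w) ^+ 2) by exact: gain_integrable_sqr.
have iY2 : integ (fun w => Y (X 0%N w) ^+ 2).
  rewrite (_ : (fun w => _) = fun w => `|X 0%N w| `^ (p * 2)).
    by apply: (gaussian_integrable_powR hlaw); rewrite mulr_gt0.
  by apply/funext => w; rewrite powRrM powR_mulrn// powR_ge0.
pose VY := \int[P]_w (Y (X 0%N w) - mu) ^+ 2.
pose VZ := \int[P]_w (Z (X 0%N w) - D) ^+ 2.
have VY0 : 0 <= VY by rewrite Rintegral_ge0// => w _; exact: sqr_ge0.
have VZ0 : 0 <= VZ by rewrite Rintegral_ge0// => w _; exact: sqr_ge0.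
pose s := @root8 R.
(* A quarter of [D s^5 / 2], the lower bound for the mean gain of a block of at least [s^5 / 2]
   coordinates. *)
pose l d := D / 8 * s d ^+ 5.
have block d : exists m, 2 <= s d ->
    [/\ (m <= d)%N, m%:R <= s d ^+ 5 & s d ^+ 5 / 2 <= m%:R].
  have [s2|s2] := leP 2 (s d); last by exists 0%N.
  by have [m hm] := block_size (root8_exp8 R d) s2; exists m.
pose m d := projT1 (cid (block d)).
have mP d : 2 <= s d ->
    [/\ (m d <= d)%N, (m d)%:R <= s d ^+ 5 & s d ^+ 5 / 2 <= (m d)%:R].
  exact: projT2 (cid (block d)).
pose theta : triangular_array R :=
  fun d => \row_(i < d) if (i < m d)%N then b + 1 else 0.
pose BY d := [set w | l d <= `|\sum_(i < d) Y (X i w) - d%:R * mu|].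
pose BZ d := [set w | l d *+ 2 <= `|\sum_(i < m d) Z (X i w) - (m d)%:R * D|].
have mBY d : measurable (BY d).
  apply: measurable_geR; apply: measurableT_comp => //; apply: measurable_funB => //.
  by apply: measurable_sum => i; exact: (measurable_comp_RV X _ mY).
have mBZ d : measurable (BZ d).
  apply: measurable_geR; apply: measurableT_comp => //; apply: measurable_funB => //.
  by apply: measurable_sum => i; exact: (measurable_comp_RV X _ mZ).
have l0 d : 2 <= s d -> 0 < l d.
  by move=> s2; rewrite mulr_gt0 ?divr_gt0// exprn_gt0//; lra.
pose CY := VY * (8 / D) ^+ 2.
pose CZ := VZ * (4 / D) ^+ 2.
have CY0 : 0 <= CY by rewrite mulr_ge0// sqr_ge0.
have CZ0 : 0 <= CZ by rewrite mulr_ge0// sqr_ge0.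
have pY d : 2 <= s d -> prob P (BY d) <= CY / s d.
  move=> s2; have s0 : 0 < s d by lra.
  apply: le_trans (iid_chebyshev hind hid d mY (l0 d s2) iY2) _.
  rewrite -/mu -/VY -(root8_exp8 R d) -/(s d).
  (* The variance of the noise sum is of order [s^8] and [l^2] of order [s^10]. *)
  rewrite (_ : _ / _ = CY / s d ^+ 2); last first.
    by rewrite /CY /l; field; rewrite !gt_eqF.
  by rewrite ler_wpM2l// lef_pV2 ?posrE ?exprn_gt0// ler_eXnr//; lra.
have pZ d : 2 <= s d -> prob P (BZ d) <= CZ / s d.
  move=> s2; have s0 : 0 < s d by lra.
  have [md ms sm] := mP d s2.
  have l20 : 0 < l d *+ 2 by rewrite pmulrn_lgt0// l0.
  apply: le_trans (iid_chebyshev hind hid (m d) mZ l20 iZ2) _.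
  rewrite -/D -/VZ.
  apply: (@le_trans _ _ (s d ^+ 5 * VZ / (l d *+ 2) ^+ 2)).
    by rewrite ler_wpM2r ?invr_ge0 ?sqr_ge0// ler_wpM2r.
  rewrite (_ : _ / _ = CZ / s d ^+ 5); last first.
    by rewrite /CZ /l -mulr_natr; field; rewrite !gt_eqF.
  by rewrite ler_wpM2l// lef_pV2 ?posrE ?exprn_gt0// ler_eXnr//; lra.
exists theta.
  apply: (@consistent_of_le _ _ _ _ _ _ _ _ (fun d => (CY + CZ) / s d)).
    exact: cvg_div_root8.
  near=> d.
  have s2 : 2 <= s d by near: d; exact: near_root8_ge.
  have kp0 : 0 < kappa_p d by near: d; exact: near_critical_gt0 hp ap1.
  have [md ms sm] := mP d s2.
  (* A larger critical value would force the size below [CY / s], hence to 0, against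
     [alpha_p > 0]. *)
  have kl : kappa_p d `^ p <= d%:R * mu + l d.
    rewrite leNgt; apply/negP => lk.
    have : size0 p%:E kappa_p d <= CY / s d.
      apply: le_trans (pY d s2); apply: le_prob => //; first exact: measurable_rejection.
      move=> w /(rejectionP _ _ p0 kp0) kS; rewrite /BY /=.
      have E : \sum_(i < d) `|(0 + noise X d w)%R ord0 i| `^ p = \sum_(i < d) Y (X i w).
        by apply: eq_bigr => i _; rewrite shifted_noiseE mxE add0r.
      rewrite E in kS; apply: le_trans (ler_norm _).
      by rewrite lerBrDl; exact: le_trans (ltW lk) kS.
    apply/negP; rewrite -ltNge; apply: (@lt_trans _ _ (alpha_p / 2)).
      near: d; apply: (cvgr_lt 0); first exact: cvg_div_root8.
      by rewrite divr_gt0.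
    by near: d; apply: (cvgr_gt _ hp); rewrite gtr_pMr// invf_lt1// ltr1n.
  rewrite lerBlDr addrC -lerBlDr -prob_setC; last exact: measurable_rejection.
  rewrite mulrDl; apply: le_trans (lerD (pY d s2) (pZ d s2)).
  apply: prob_le_setU => //; first by apply: measurableC; exact: measurable_rejection.
  move=> w nrej.
  have [|BYw] := leP (l d) `|\sum_(i < d) Y (X i w) - d%:R * mu|; first by left.
  have [|BZw] := leP (l d *+ 2) `|\sum_(i < m d) Z (X i w) - (m d)%:R * D|; first by right.
  exfalso; apply: nrej; apply/(rejectionP _ _ p0 kp0).
  have th i : theta d ord0 i = if (i < m d)%N then b + 1 else 0 by rewrite mxE.
  apply: le_trans (sum_shift_ge w p0 (ltW b0) md th).
  apply: le_trans kl _.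
  have hl : l d *+ 4 <= (m d)%:R * D.
    rewrite -mulr_natr (_ : l d * 4 = s d ^+ 5 / 2 * D); last by rewrite /l; field.
    by rewrite ler_wpM2r// ltW.
  exact: deviation_le BYw BZw hl.
have b10 : 0 <= b + 1 by rewrite addr_ge0// ltW.
have [C C0 near_C] := near_shifted_exceedance_le b10 hoo aoo1.
apply: (@not_consistent_of_le _ _ _ _ _ _ _ alpha_oo _ (fun d => C / s d) hoo aoo1).
  exact: cvg_div_root8.
near=> d.
have s2 : 2 <= s d by near: d; exact: near_root8_ge.
have koo0 : 0 < kappa_oo d by near: d; exact: near_critical_gt0 hoo aoo1.
have [md ms sm] := mP d s2.
have hC : s d ^+ 5 * prob P (X 0%N @^-1` [set x | kappa_oo d - (b + 1) <= `|x|]) <=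
    C / s d by near: d; exact: near_C.
set A := [set x : R | kappa_oo d - (b + 1) <= `|x|].
have mA : measurable A by exact: measurable_abs_ge.
(* A coordinate reaching [kappa_oo] either lies outside the block, and then the test also rejects
   without signal, or lies inside it with noise of modulus at least [kappa_oo - (b + 1)]. *)
pose U := \big[setU/set0]_(i < m d) (X i @^-1` A).
have mU : measurable U by apply: bigsetU_measurable => i _; exact: measurable_RV.
apply: (@le_trans _ _ (size0 +oo%E kappa_oo d + prob P U)).
  apply: prob_le_setU => //; [exact: measurable_rejection|exact: measurable_rejection|].
  move=> w; rewrite /rejection /mkset => /(le_pnorm_ooP _ koo0)[i].
  rewrite shifted_noiseE mxE; case: ifP => im kX; last first.
    left; apply/(le_pnorm_ooP _ koo0); exists i.
    by rewrite shifted_noiseE mxE.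
  right; rewrite /U -(bigcup_mkord (m d) (fun i => X i @^-1` A)).
  exists (nat_of_ord i) => //=; rewrite /A /= lerBlDl.
  by apply: le_trans kX _; rewrite (le_trans (ler_normD _ _))// ger0_norm.
rewrite lerD2l; apply: (@le_trans _ _ (s d ^+ 5 * prob P (X 0%N @^-1` A))); last exact: hC.
apply: le_trans (@prob_le_bigU _ _ _ P U (m d) (fun i => X i @^-1` A) mU _ _) _ => //.
  by move=> i; exact: measurable_RV.
rewrite (eq_bigr (fun=> prob P (X 0%N @^-1` A))); last first.
  by move=> i _; exact: (iid_prob hid).
by rewrite sumr_const card_ord -mulr_natl ler_wpM2r ?prob_ge0.
Unshelve. all: by end_near. Qed.

End gaussian_norm_tests.

Theorem corollary3p6 (R : realType) (disp : measure_display)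
    (T : measurableType disp) (P : probability T R)
    (eps : nat -> {RV P >-> R}) (heps : iid_standard_normal eps)
    (p : R) (hp : 0 < p) (kappa_p kappa_oo : nat -> R)
    (hsize_p : exists alpha : R,
       0 < alpha < 1 /\ asymptotic_size eps (norm_test p%:E kappa_p) alpha)
    (hsize_oo : exists alpha : R,
       0 < alpha < 1 /\ asymptotic_size eps (norm_test +oo%E kappa_oo) alpha) :
  ~ (consistency_set eps (norm_test p%:E kappa_p)
       `<=` consistency_set eps (norm_test +oo%E kappa_oo)) /\
  ~ (consistency_set eps (norm_test +oo%E kappa_oo)
       `<=` consistency_set eps (norm_test p%:E kappa_p)).
Proof.
have [ap [/andP[ap0 ap1] /asymptotic_size_cvg hp']] := hsize_p.
have [aoo [/andP[aoo0 aoo1] /asymptotic_size_cvg hoo]] := hsize_oo.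
split=> sub.
  have [|theta cp noo] := block_separates heps hp hp' _ hoo aoo1; first by rewrite ap0.
  by apply: noo; exact: sub.
have [|theta coo np] := spike_separates heps hp hp' ap1 hoo _; first by rewrite aoo0.
by apply: np; exact: sub.
Qed.
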